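(* Let $G\in H^\infty_{m\times p}$ be such that $T_GT_G^*$ is strictly positive. Then the function $$Y(z)=I_p-zE_p^*(I-zS_p^* )^{-1}T_G^*(T_GT_G^* )^{-1}H_GE_p\quad(z\in\mathbb{D})$$ as well as the function $Y(\cdot)^{-1}$ are in $H^2_{p\times p}$. In particular, $\det Y(z)\neq0$ for almost every $z\in\mathbb{T}$.
   Context: $\mathbb{D}$ is the open unit disc, $\mathbb{T}$ the unit circle. $H^\infty_{r\times s}$ and $H^2_{r\times s}$ are the spaces of $r\times s$ matrices with entries in $H^\infty$, respectively $H^2$, of $\mathbb{D}$; values of an $H^2$ function on $\mathbb{T}$ are its non-tangential limits, which exist almost everywhere. $Y(\cdot)^{-1}$ denotes the function $z\mapsto Y(z)^{-1}$ on $\mathbb{D}$. $\ell^2_+(\mathbb{C}^n)$ is the space of square summable sequences in $\mathbb{C}^n$ indexed by $0,1,2,\ldots$ For $G\in H^\infty_{m\times p}$ with Taylor coefficients $G_0,G_1,\ldots$ at zero, $T_G:\ell^2_+(\mathbb{C}^p)\to\ell^2_+(\mathbb{C}^m)$ is the analytic Toeplitz operator whose $(i,j)$ block entry ($i,j\ge0$) is $G_{i-j}$ if $i\ge j$ and $0$ otherwise, and $H_G:\ell^2_+(\mathbb{C}^p)\to\ell^2_+(\mathbb{C}^m)$ is the Hankel operator whose $(i,j)$ block entry is $G_{i+j+1}$. A selfadjoint operator is strictly positive if it is $\ge\delta I$ for some $\delta>0$. $S_n$ is the block forward shift on $\ell^2_+(\mathbb{C}^n)$, and $E_n=\begin{bmatrix}I_n&0&0&\cdots\end{bmatrix}^\top:\mathbb{C}^n\to\ell^2_+(\mathbb{C}^n)$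 is the embedding onto the first coordinate space. *)

(* Defs.v *)
From HB Require Import structures.
From mathcomp Require Import all_boot all_order all_algebra.
From mathcomp Require Import complex ring.
From mathcomp Require Import all_classical all_reals all_analysis.

Set Implicit Arguments.
Unset Strict Implicit.
Unset Printing Implicit Defensive.

Import Order.TTheory GRing.Theory Num.Theory.
Import numFieldNormedType.Exports.
Import ComplexField.Normc.

Local Open Scope classical_set_scope.
Local Open Scope ring_scope.

(* The library puts a topology on abstract numFieldTypes and on [R[i]^o], but
   not on [R[i]] itself. *)
HB.instance Definition _ (R : realType) := NormedModule.copy R[i] R[i]^o.

Section SquareSummable.
Context {R : realType} {n : nat}.
Implicit Types (v w : 'cV[R[i]]_n) (x y : nat -> 'cV[R[i]]_n).

Definition sqnorm v : R := \sum_(i < n) normc (v i ord0) ^+ 2.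

Definition square_summable : {pred nat -> 'cV[R[i]]_n} :=
  fun x => (\sum_(0 <= k <oo) (sqnorm (x k))%:E < +oo)%E.

Lemma sqnorm_ge0 v : 0 <= sqnorm v.
Proof. by rewrite sumr_ge0 // => i _; rewrite sqr_ge0. Qed.

Lemma sqnorm0 : sqnorm 0 = 0.
Proof. by rewrite /sqnorm big1 // => i _; rewrite mxE normc0 expr0n. Qed.

Lemma sqnormZ a v : sqnorm (a *: v) = normc a ^+ 2 * sqnorm v.
Proof.
by rewrite mulr_sumr; apply: eq_bigr => i _; rewrite mxE normcM exprMn.
Qed.

Lemma sqnormD v w : sqnorm (v + w) <= 2 * (sqnorm v + sqnorm w).
Proof.
rewrite -big_split mulr_sumr; apply: ler_sum => i _; rewrite mxE /=.
have h0 (z : R[i]) : 0 <= normc z by case: z => a b; exact: sqrtr_ge0.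
apply: (@le_trans _ _ ((normc (v i ord0) + normc (w i ord0)) ^+ 2)).
  by rewrite ler_sqr ?nnegrE ?addr_ge0 // le_normcD.
set a := normc _; set b := normc _.
rewrite -subr_ge0; suff -> : 2 * (a ^+ 2 + b ^+ 2) - (a + b) ^+ 2 = (a - b) ^+ 2.
  exact: sqr_ge0.
by ring.
Qed.
End SquareSummable.


Section SquareSummableClosed.
Context {R : realType} {n : nat}.

Let sqn_ge0 (x : nat -> 'cV[R[i]]_n) k : (0 <= (sqnorm (x k))%:E)%E.
Proof. by rewrite lee_fin sqnorm_ge0. Qed.

Lemma square_summable_submod : submod_closed (@square_summable R n).
Proof.
split=> [|a x y].
  by rewrite unfold_in eseries0 // => k _ _; rewrite sqnorm0.
rewrite !unfold_in => xoo yoo.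
pose c := normc a ^+ 2.
have c_ge0 : 0 <= 2 * c :> R by rewrite mulr_ge0 ?sqr_ge0.
apply: (@le_lt_trans _ _ ((2 * c)%:E * (\sum_(0 <= k <oo) (sqnorm (x k))%:E)
    + 2%:E * \sum_(0 <= k <oo) (sqnorm (y k))%:E)%E).
  rewrite -!nneseriesZl -?nneseriesD; try by move=> *; rewrite ?mule_ge0 ?sqn_ge0.
  apply: lee_nneseries => k _; first by move=> _; exact: sqn_ge0.
  rewrite -!EFinM -EFinD lee_fin (le_trans (sqnormD _ _)) //.
  by rewrite sqnormZ mulrDr mulrA.
by rewrite lte_add_pinfty // lte_mul_pinfty.
Qed.

HB.instance Definition _ := GRing.isSubmodClosed.Build R[i]
  (nat -> 'cV[R[i]]_n) (@square_summable R n) square_summable_submod.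

Record ell2 := Ell2 {
  ell2_seq :> nat -> 'cV[R[i]]_n;
  ell2P : ell2_seq \in square_summable }.

HB.instance Definition _ := [isSub for ell2_seq].
HB.instance Definition _ := [Choice of ell2 by <:].
HB.instance Definition _ := [SubChoice_isSubLmodule of ell2 by <:].

Lemma single_square_summable (j : nat) (v : 'cV[R[i]]_n) :
  (fun k => if k == j then v else 0) \in square_summable.
Proof.
rewrite unfold_in (@nneseriesD1 _ _ j) // => [|k _].
  rewrite eqxx eseries0 ?adde0 ?ltry // => k _ /negPf ->.
  by rewrite sqnorm0.
by rewrite lee_fin sqnorm_ge0.
Qed.

Lemma shift_square_summable (x : ell2) :
  (fun k => if k is k'.+1 then x k' else 0) \in square_summable.
Proof.
rewrite unfold_in nneseries_recl // => [|k _]; last first.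
  by rewrite lee_fin sqnorm_ge0.
rewrite sqnorm0 add0e -(@nneseries_addn _ _ 1) => [|k].
  by under eq_eseriesr do rewrite addn1; have := ell2P x; rewrite unfold_in.
by rewrite lee_fin sqnorm_ge0.
Qed.
End SquareSummableClosed.

Arguments ell2 R n : clear implicits.
Arguments single_square_summable {R n} j v.

Section Operators.
Context {R : realType}.
Local Notation C := R[i].
Local Notation "''l2_' n" := (ell2 R n) (at level 8, n at level 2).

Definition cdot n (v w : 'cV[C]_n) : C := \sum_(i < n) v i ord0 * (w i ord0)^*.

Definition l2dot n (x y : 'l2_n) : C := limn (series (fun k => cdot (x k) (y k))).

Definition l2norm n (x : 'l2_n) : R :=
  Num.sqrt (fine (\sum_(0 <= k <oo) (sqnorm (x k))%:E)%E).

Definition bounded_operator p m (T : 'l2_p -> 'l2_m) : Prop :=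
  linear T /\ exists M : R, forall x, l2norm (T x) <= M * l2norm x.

(* [adjoint] and [inverse] pick the function satisfying the defining equations,
   which is unique when it exists; the junk value is the zero map. *)
Definition adjoint (U V : lmodType C) (dotU : U -> U -> C) (dotV : V -> V -> C)
    (T : U -> V) : V -> U :=
  xget (fun=> 0) [set T' | forall u v, dotV (T u) v = dotU u (T' v)].

Definition inverse (U : lmodType C) (T : U -> U) : U -> U :=
  xget (fun=> 0) [set T' | cancel T T' /\ cancel T' T].

Definition strictly_positive n (T : 'l2_n -> 'l2_n) : Prop :=
  (forall x y, l2dot (T x) y = l2dot x (T y)) /\
  exists2 delta : R, 0 < delta &
    forall x, (delta%:C)%C * l2dot x x <= l2dot (T x) x.

Definition l2single n (j : nat) (v : 'cV[C]_n) : 'l2_n :=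
  Ell2 (single_square_summable j v).

Definition l2embed n (v : 'cV[C]_n) : 'l2_n := l2single 0 v.

Definition shift n (x : 'l2_n) : 'l2_n := Ell2 (shift_square_summable x).

(* The bounded operator with block matrix [A]; when there is none, the junk
   value is the zero operator. *)
Definition block_operator p m (A : nat -> nat -> 'M[C]_(m, p)) :
    'l2_p -> 'l2_m :=
  xget (fun=> 0) [set T | bounded_operator T /\
    forall i j (v : 'cV[C]_p), T (l2single j v) i = A i j *m v].

Definition matrix_of n (f : 'cV[C]_n -> 'cV[C]_n) : 'M[C]_n :=
  \matrix_(i, j) f (delta_mx j ord0) i ord0.

End Operators.

Section Hardy.
Context {R : realType}.
Local Notation C := R[i].

(* [derive1n] is taken over the field [R[i]]: these are complex derivatives. *)
Definition taylor (f : C -> C) (n : nat) : C := derive1n n f 0 / n`!%:R.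

(* Functions on the open unit disc are represented by total functions whose
   values outside of the disc are irrelevant. *)
Definition analytic_disc (f : C -> C) : Prop :=
  forall z : C, `|z| < 1 ->
    series (fun n => taylor f n * z ^+ n) @ \oo --> f z.

Definition hardy_inf (f : C -> C) : Prop :=
  analytic_disc f /\ exists M : R, forall z : C, `|z| < 1 -> normc (f z) <= M.

Definition circle_point (r t : R) : C := ((r * cos t) +i* (r * sin t))%C.

Definition hardy_2 (f : C -> C) : Prop :=
  analytic_disc f /\ exists M : R, forall r : R, 0 <= r < 1 ->
    (\int[lebesgue_measure]_(t in `[0%R, (2 * pi)%R])
       (normc (f (circle_point r t)) ^+ 2)%:E <= M%:E)%E.

Definition hardy_inf_mx m p (F : C -> 'M[C]_(m, p)) : Prop :=
  forall i j, hardy_inf (fun z => F z i j).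

Definition hardy_2_mx m p (F : C -> 'M[C]_(m, p)) : Prop :=
  forall i j, hardy_2 (fun z => F z i j).

Definition taylor_mx m p (F : C -> 'M[C]_(m, p)) (n : nat) : 'M[C]_(m, p) :=
  \matrix_(i, j) taylor (fun z => F z i j) n.

(* Empty for [alpha <= 1] when [zeta] is on the unit circle. *)
Definition stolz_region (alpha : R) (zeta : C) : set C :=
  [set z | `|z| < 1 /\ `|z - zeta| < (alpha%:C)%C * (1 - `|z|)].

Definition nontangential_limit m p (F : C -> 'M[C]_(m, p)) (zeta : C)
    (L : 'M[C]_(m, p)) : Prop :=
  forall alpha : R, 1 < alpha ->
    F z @[z --> within (stolz_region alpha zeta) (nbhs zeta)] --> L.

Definition Toeplitz m p (G : C -> 'M[C]_(m, p)) : ell2 R p -> ell2 R m :=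
  block_operator (fun i j => if (j <= i)%N then taylor_mx G (i - j) else 0).

Definition Hankel m p (G : C -> 'M[C]_(m, p)) : ell2 R p -> ell2 R m :=
  block_operator (fun i j => taylor_mx G (i + j + 1)).

(* [T_G T_G^*], an operator on the codomain of [T_G] *)
Definition Toeplitz_gram m p (G : C -> 'M[C]_(m, p)) : ell2 R m -> ell2 R m :=
  Toeplitz G \o adjoint (@l2dot R p) (@l2dot R m) (Toeplitz G).

Definition Y_fun m p (G : C -> 'M[C]_(m, p)) (z : C) : 'M[C]_p :=
  let TG' := adjoint (@l2dot R p) (@l2dot R m) (Toeplitz G) in
  let Sp' := adjoint (@l2dot R p) (@l2dot R p) (@shift R p) in
  let Ep' := adjoint (@cdot R p) (@l2dot R p) (@l2embed R p) in
  1%:M - z *: matrix_of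
    (Ep' \o inverse (fun x => x - z *: Sp' x) \o TG' \o
     inverse (Toeplitz_gram G) \o Hankel G \o @l2embed R p).

End Hardy.

(* Main.v *)
Require Import Defs.
From HB Require Import structures.
From mathcomp Require Import all_boot all_order all_algebra.
From mathcomp Require Import complex ring lra.
From mathcomp Require Import all_classical all_reals all_analysis measurable_realfun.

(** Write [T] for the Toeplitz operator of [G], [T'] for its adjoint, [Q] for the inverse
   of [T T'], [H] for the Hankel operator, [E] for the embedding of the first coordinate,
   [E'] for its adjoint and [S'] for the backward shift on [ell^2].  Put [K = T' Q], a
   right inverse of [T], and [B = H E = S' T E].

   The Taylor coefficients of [Y (z) = 1 - z E' (1 - z S')^-1 K B] are, but for the constant
   term and the sign, the coordinates of [K B], which is why [Y] belongs to [H^2].  For the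
   inverse, [T] commutes with the forward shift, so that [T'] commutes with [S'] and
   [S' T = T S' + B E'].  Since [K T] is the identity on the range of [T'], which
   [S'] preserves, this gives [K S' = S' K + K B E' K] ([right_inverse_bshift]).  The
   state space formula for the inverse of [Y] then collapses ([Y_mulmx_W]) to
   [W (z) = 1 + z E' K (1 - z S')^-1 B], whose Taylor coefficients are [E' K S'^n H E].  A
   Hankel operator satisfies [S' H = H S], where [S] is the forward shift, so these
   coefficients are the block entries of the bounded operator [E' K H] from [ell^2] to
   [C^p], and they are square summable too ([l2_coef_functional]).

   Square summable coefficients give a function of [H^2] by Parseval's identity
   ([power_sum_hardy_2]), with nontangential limits almost everywhere by Fatou's theorem
   ([l2_nontangential]).  Fatou's theorem rests on a bound of a polynomial in a Stolz region
   by the maximal function of its modulus on the circle ([stolz_maximal]), a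
   consequence of Poisson's formula, and on the maximal inequality of Hardy and
   Littlewood.  Where [Y] and [W] both have a limit, the product of the two limits is [1], so
   the limit of [Y] is invertible ([hardy_inverse_pair]).

   The definitions of the operators return the zero map when the operator they describe
   does not exist.  Should this happen, [Y] is the constant function [1], for which
   the conclusions are immediate ([hardy_invertible_identity]). *)


Set Implicit Arguments.
Unset Strict Implicit.
Unset Printing Implicit Defensive.

Import Order.TTheory GRing.Theory Num.Theory.
Import numFieldNormedType.Exports.
Import ComplexField.Normc.

Local Open Scope classical_set_scope.
Local Open Scope ring_scope.

Local Notation Re := complex.Re.
Local Notation Im := complex.Im.

(** * Convergence in the complex plane *)

Section ComplexNorm.
Context {R : realType}.
Local Notation C := R[i].
Implicit Types (z w : C) (r : R).

Lemma normcE z : `|z| = (normc z)%:C%C.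
Proof. by []. Qed.

Lemma normc_lt z r : (`|z| < r%:C%C) = (normc z < r).
Proof. by rewrite normcE ltcR. Qed.

Lemma normc_lt1 z : (`|z| < 1) = (normc z < 1).
Proof. exact: (normc_lt z 1). Qed.

Lemma normc_ge0 z : 0 <= normc z.
Proof. by case: z => a b; exact: sqrtr_ge0. Qed.

Lemma normcX z n : normc (z ^+ n) = normc z ^+ n.
Proof.
elim: n => [|n IH]; first by rewrite !expr0 normc1.
by rewrite !exprS normcM IH.
Qed.

Lemma normc_real r : normc r%:C%C = `|r|.
Proof. by rewrite /= expr0n /= addr0 sqrtr_sqr. Qed.

Lemma normc_nat n : normc (n%:R : C) = n%:R.
Proof. by rewrite -(rmorph_nat (real_complex R)) normc_real ger0_norm. Qed.

Lemma normc_conj z : normc z^* = normc z.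
Proof. by case: z => a b /=; rewrite sqrrN. Qed.

Lemma conj_real_complex r : (r%:C%C : C)^* = r%:C%C.
Proof. exact: conjc_real. Qed.

Lemma normcB z w : normc (z - w) = normc (w - z).
Proof. by rewrite -normcN opprB. Qed.

Lemma normc_sum (I : Type) (s : seq I) (P : pred I) (F : I -> C) :
  normc (\sum_(i <- s | P i) F i) <= \sum_(i <- s | P i) normc (F i).
Proof.
elim/big_ind2 : _ => //; first by rewrite normc0.
by move=> a b c d ab cd; exact: le_trans (le_normcD _ _) (lerD ab cd).
Qed.

Lemma sqr_normcE z : normc z ^+ 2 = Re z ^+ 2 + Im z ^+ 2.
Proof. by case: z => a b /=; rewrite sqr_sqrtr // addr_ge0 // sqr_ge0. Qed.

Lemma normcJ z : z * z^* = (normc z ^+ 2)%:C%C.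
Proof. by rewrite sqr_normcE; case: z => a b; simpc; congr Complex; ring. Qed.

Lemma le_Re_normc z : `|Re z| <= normc z.
Proof. by have := normc_ge_Re z; rewrite normcE lecR. Qed.

Lemma le_Im_normc z : `|Im z| <= normc z.
Proof.
by case: z => a b /=; rewrite -sqrtr_sqr ler_wsqrtr // lerDr sqr_ge0.
Qed.

Lemma normc_le_ReIm z : normc z <= `|Re z| + `|Im z|.
Proof.
rewrite {1}(complexE z) (le_trans (le_normcD _ _)) // normcM !normc_real.
by rewrite [normc 'i%C]/= expr0n /= add0r expr1n sqrtr1 mul1r.
Qed.

(** Limits in [C] become limits of real sequences, to which the lemmas on ordered
   fields apply. *)
Lemma cvg_normcP {T : Type} {F : set_system T} {FF : Filter F} (u : T -> C) l :
  u @ F --> l <-> normc (u x - l) @[x --> F] --> 0.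
Proof.
split=> [/cvgrPdist_lt ul|/cvgrPdist_lt ul]; apply/cvgrPdist_lt => e e0.
- near=> x; rewrite sub0r normrN ger0_norm ?normc_ge0 // normcB -normc_lt.
  by near: x; apply: ul; rewrite ltcE /= eqxx.
- have : e \is Num.real by rewrite gtr0_real.
  case/complex_realP => d de; subst e.
  have d0 : 0 < d by rewrite -ltcR.
  near=> x; rewrite normc_lt normcB -[ltLHS]ger0_norm ?normc_ge0 //.
  by rewrite -normrN -sub0r; near: x; exact: ul.
Unshelve. all: by end_near. Qed.

Lemma cvg_normc_le {T : Type} {F : set_system T} {FF : ProperFilter F}
  (u : T -> C) l (B : R) :
  u @ F --> l -> (\forall x \near F, normc (u x) <= B) -> normc l <= B.
Proof.
move=> /cvg_normcP ul uB; apply/ler_addgt0Pr => e e0.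
have /cvgrPdist_lt/(_ e e0) ue := ul.
near F => x.
rewrite -(subrK (u x) l) (le_trans (le_normcD _ _)) // addrC lerD //.
  by near: x.
rewrite normcB -[leLHS]ger0_norm ?normc_ge0 // -normrN -sub0r ltW //.
by near: x.
Unshelve. all: by end_near. Qed.

Lemma cvg_ReIm {T : Type} {F : set_system T} {FF : Filter F} (u : T -> C) a b :
  Re (u x) @[x --> F] --> a -> Im (u x) @[x --> F] --> b ->
  u @ F --> (a +i* b)%C.
Proof.
move=> ua ub; apply/cvg_normcP.
have h : (`|Re (u x) - a| + `|Im (u x) - b|) @[x --> F] --> 0.
  rewrite -(addr0 0) -{1}(normr0 R) -{2}(normr0 R) -{1}(subrr a) -(subrr b).
  by apply: cvgD; apply: cvg_norm; apply: cvgB => //; exact: cvg_cst.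
apply: (squeeze_cvgr _ (cvg_cst 0) h).
near=> x; rewrite normc_ge0 /= (le_trans (normc_le_ReIm _)) //.
by case: (u x).
Unshelve. all: by end_near. Qed.

Lemma Re_sum (I : Type) (s : seq I) (P : pred I) (F : I -> C) :
  Re (\sum_(i <- s | P i) F i) = \sum_(i <- s | P i) Re (F i).
Proof. by elim/big_rec2 : _ => // i a b _ <-; case: b; case: (F i). Qed.

Lemma Im_sum (I : Type) (s : seq I) (P : pred I) (F : I -> C) :
  Im (\sum_(i <- s | P i) F i) = \sum_(i <- s | P i) Im (F i).
Proof. by elim/big_rec2 : _ => // i a b _ <-; case: b; case: (F i). Qed.

Lemma bounded_series_is_cvg (v : R ^nat) B :
  (forall n, \sum_(k < n) `|v k| <= B) -> cvgn (series v).
Proof.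
move=> vB; apply: normed_cvg; apply: nondecreasing_is_cvgn.
  by apply: nondecreasing_series => k _ _; exact: normr_ge0.
exists B => _ [n _ <-].
by have := vB n; rewrite -(big_mkord xpredT (fun k => `|v k|)).
Qed.

(** Completeness is inherited from [R] through the real and imaginary parts. *)
Lemma normal_series_is_cvg (u : C ^nat) B :
  (forall n, \sum_(k < n) normc (u k) <= B) -> cvgn (series u).
Proof.
move=> uB; apply/cvg_ex.
have cR : cvgn (series (fun k => Re (u k))).
  apply: (@bounded_series_is_cvg _ B) => n.
  by rewrite (le_trans _ (uB n)) // ler_sum // => k _; exact: le_Re_normc.
have cI : cvgn (series (fun k => Im (u k))).
  apply: (@bounded_series_is_cvg _ B) => n.
  by rewrite (le_trans _ (uB n)) // ler_sum // => k _; exact: le_Im_normc.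
eexists; apply: cvg_ReIm.
- by rewrite (_ : (fun n => _) = series (fun k => Re (u k)));
    [exact: cR|apply/funext => n; rewrite Re_sum].
- by rewrite (_ : (fun n => _) = series (fun k => Im (u k)));
    [exact: cI|apply/funext => n; rewrite Im_sum].
Qed.

End ComplexNorm.

(** * Power series and their Taylor coefficients *)

Section PowerSeries.
Context {R : realType}.
Local Notation C := R[i].
Implicit Types (a : C ^nat) (z h : C) (r : R).

(** Absolute convergence in the open disc, by bounded partial sums: a property
   that formal differentiation visibly preserves. *)
Definition disc_summable a := forall r, 0 <= r -> r < 1 ->
  exists B : R, forall n, \sum_(k < n) normc (a k) * r ^+ k <= B.

Definition power_sum a z : C := limn (series (fun k => a k * z ^+ k)).

Definition power_deriv a : C ^nat := fun k => k.+1%:R * a k.+1.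

Lemma power_sum_cvg a z : disc_summable a -> normc z < 1 ->
  series (fun k => a k * z ^+ k) @ \oo --> power_sum a z.
Proof.
move=> da z1; have [B aB] := da _ (normc_ge0 z) z1.
apply: (@normal_series_is_cvg _ _ B) => n; rewrite (le_trans _ (aB n)) //.
by apply: ler_sum => k _; rewrite normcM normcX.
Qed.

(** A term of the binomial expansion of [(x + y) ^+ n.+1].  It absorbs the factor
   [n + 1] produced by differentiation into a slightly larger radius. *)
Lemma natr_expr_le (x y : R) n : 0 <= x -> 0 <= y ->
  n.+1%:R * x ^+ n * y <= (x + y) ^+ n.+1.
Proof.
move=> x0 y0; elim: n => [|n IH]; first by rewrite !expr1 expr0 !mul1r lerDr.
rewrite [leRHS]exprSr mulrDr (_ : n.+2%:R * _ * y =
  n.+1%:R * x ^+ n * y * x + x ^+ n.+1 * y); last first.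
  by rewrite -[n.+2%:R]natr1 [x ^+ n.+1]exprSr; ring.
apply: lerD; first exact: ler_wpM2r.
by rewrite ler_wpM2r // lerXn2r ?nnegrE ?addr_ge0 // lerDl.
Qed.

Lemma midpoint_lt1 r : r < 1 -> [/\ 0 < (1 - r) / 2, r + (1 - r) / 2 < 1 &
   0 <= r -> 0 <= r + (1 - r) / 2].
Proof. by move=> r1; split; lra. Qed.

Lemma power_deriv_summable a : disc_summable a ->
  disc_summable (power_deriv a).
Proof.
move=> da r r0 r1; have [e0 A1 A0] := midpoint_lt1 r1.
set e := (1 - r) / 2 in e0 A1 A0 *.
have [B aB] := da _ (A0 r0) A1.
exists (B / e) => n; rewrite ler_pdivlMr // mulr_suml (le_trans _ (aB n.+1)) //.
rewrite big_ord_recl /= ler_wpDl ?mulr_ge0 ?normc_ge0 ?exprn_ge0 ?A0 //.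
apply: ler_sum => k _; rewrite /bump /= add1n /power_deriv normcM normc_nat.
rewrite (_ : _ * e = normc (a k.+1) * (k.+1%:R * r ^+ k * e)); last by ring.
by rewrite ler_wpM2l ?normc_ge0 // natr_expr_le // ltW.
Qed.

(** The bound is a multiple of [(normc z + e) ^+ n], here and in the next lemma, so
   that absolute convergence at the radius [normc z + e < 1] sums it; no factor
   polynomial in [n] appears. *)
Lemma expr_first_order z h (e : R) n : 0 < e -> normc h <= e ->
  normc ((z + h) ^+ n - z ^+ n) <= normc h / e * (normc z + e) ^+ n.
Proof.
move=> e0 he; elim: n => [|n IH].
  by rewrite !expr0 subrr normc0 mulr1 divr_ge0 ?normc_ge0 // ltW.
rewrite (_ : _ - _ = z * ((z + h) ^+ n - z ^+ n) + h * (z + h) ^+ n); last first.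
  by rewrite !exprS; ring.
rewrite (le_trans (le_normcD _ _)) // !normcM normcX.
rewrite (_ : normc h / e * _ = normc z * (normc h / e * (normc z + e) ^+ n) +
  normc h * (normc z + e) ^+ n); last by rewrite exprS; field; rewrite gt_eqF.
apply: lerD; first by rewrite ler_wpM2l ?normc_ge0.
rewrite ler_wpM2l ?normc_ge0 // lerXn2r ?nnegrE ?addr_ge0 ?normc_ge0 ?(ltW e0) //.
by rewrite (le_trans (le_normcD _ _)) // lerD2l.
Qed.

Lemma expr_second_order z h (e : R) n : 0 < e -> normc h <= e ->
  normc ((z + h) ^+ n - z ^+ n - h * (n%:R * z ^+ n.-1)) <=
    (normc h / e) ^+ 2 * (normc z + e) ^+ n.
Proof.
move=> e0 he; elim: n => [|n IH].
  by rewrite !expr0 mul0r mulr0 subrr subr0 normc0 mulr1 sqr_ge0.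
rewrite (_ : _ - _ - _ = z * ((z + h) ^+ n - z ^+ n - h * (n%:R * z ^+ n.-1)) +
   h * ((z + h) ^+ n - z ^+ n)); last first.
  rewrite /= -natr1 !exprS; case: n {IH} => [|n] /=; first by ring.
  by rewrite !exprS; ring.
rewrite (le_trans (le_normcD _ _)) // !normcM.
rewrite (_ : (normc h / e) ^+ 2 * _ =
  normc z * ((normc h / e) ^+ 2 * (normc z + e) ^+ n) +
  normc h * (normc h / e * (normc z + e) ^+ n)); last first.
  by rewrite [_ ^+ n.+1]exprS; field; rewrite gt_eqF.
apply: lerD; first by rewrite ler_wpM2l ?normc_ge0.
by rewrite ler_wpM2l ?normc_ge0 // expr_first_order.
Qed.

Lemma power_deriv_cvg a z : disc_summable a -> normc z < 1 ->
  series (fun k => a k * (k%:R * z ^+ k.-1)) @ \oo --> power_sum (power_deriv a) z.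
Proof.
move=> da z1; rewrite -cvg_shiftS /=.
have -> : (fun n => series (fun k => a k * (k%:R * z ^+ k.-1)) n.+1) =
    series (fun k => power_deriv a k * z ^+ k).
  apply/funext => n; rewrite /series /= big_nat_recl // mul0r mulr0 add0r.
  by apply: eq_bigr => k _; rewrite /power_deriv; ring.
by apply: power_sum_cvg => //; exact: power_deriv_summable.
Qed.

(** Term by term, the difference quotient minus the formal derivative is the
   second order remainder, whose sum is [O (normc h)]. *)
Lemma power_sum_derive a (f : C -> C) z : disc_summable a ->
  (forall w, normc w < 1 -> f w = power_sum a w) -> normc z < 1 ->
  derive1 f z = power_sum (power_deriv a) z.
Proof.
move=> da fa z1; have [e0 A1 A0] := midpoint_lt1 z1.
set e := (1 - normc z) / 2 in e0 A1 A0 *.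
have [B aB] := da _ (A0 (normc_ge0 z)) A1.
set g := power_sum (power_deriv a) z.
have key h : normc h <= e ->
    normc (f (z + h) - f z - h * g) <= (normc h / e) ^+ 2 * B.
  move=> he; have zh1 : normc (z + h) < 1.
    by rewrite (le_lt_trans (le_normcD _ _)) // (le_lt_trans _ A1) // lerD2l.
  rewrite !fa //.
  have cv : (fun n => series (fun k => a k * (z + h) ^+ k) n -
      series (fun k => a k * z ^+ k) n -
      h * series (fun k => a k * (k%:R * z ^+ k.-1)) n) @ \oo -->
      power_sum a (z + h) - power_sum a z - h * g.
    by apply: cvgB; [apply: cvgB; exact: power_sum_cvg|
      apply: cvgM; [exact: cvg_cst|exact: power_deriv_cvg]].
  apply: (cvg_normc_le cv); apply: nearW => n.
  rewrite /series /= mulr_sumr -!sumrB big_mkord.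
  rewrite (le_trans (normc_sum _ _ _)) //.
  rewrite (le_trans _ (ler_wpM2l (sqr_ge0 _) (aB n))) // mulr_sumr.
  apply: ler_sum => k _.
  rewrite (_ : _ - _ = a k * ((z + h) ^+ k - z ^+ k - h * (k%:R * z ^+ k.-1)));
    last by ring.
  by rewrite normcM [leRHS]mulrCA ler_wpM2l ?normc_ge0 // expr_second_order.
rewrite /derive1; apply: cvg_lim => //; apply/cvg_normcP.
have B0 : 0 <= B by apply: le_trans (aB 0%N); rewrite big_ord0.
have c0 : normc h / e ^+ 2 * B @[h --> (0 : C)^'] --> 0.
  have : normc h @[h --> (0 : C)^'] --> 0.
    under eq_cvg do rewrite -[X in normc X]subr0.
    by apply/cvg_normcP; exact: nbhs_dnbhs.
  move=> c; rewrite -(mul0r (B)) -[X in X * B](mul0r (e ^- 2)).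
  by apply: cvgM; [apply: cvgM => //; exact: cvg_cst|exact: cvg_cst].
apply: (squeeze_cvgr _ (cvg_cst 0) c0).
have nz : \forall h \near (0 : C)^', h != 0 by exact: nbhs_dnbhs_neq.
have small : \forall h \near (0 : C)^', normc h <= e.
  near=> h; apply: ltW; rewrite -normc_lt -[X in `|X|]subr0 -normrN opprB.
  near: h; apply: nbhs_dnbhs; apply: nbhsx_ballx.
  by rewrite ltcE /= eqxx.
near=> h; rewrite normc_ge0 /=.
have h0 : h != 0 by near: h.
have nh0 : 0 < normc h.
  by rewrite lt_def normc_ge0 andbT; apply/eqP => /eq0_normc /eqP; exact/negP.
rewrite [h + z]addrC (_ : h^-1 *: _ - g = h^-1 * (f (z + h) - f z - h * g)); last first.
  by rewrite [RHS]mulrBr [h^-1 * (h * g)]mulrA mulVf // mul1r.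
rewrite normcM normcV (le_trans (ler_wpM2l _ (key h _))) //.
- by rewrite invr_ge0 ltW.
- by near: h.
- by rewrite le_eqVlt; apply/orP; left; apply/eqP; field; rewrite !gt_eqF.
Unshelve. all: by end_near. Qed.

Lemma iter_power_deriv a n k :
  iter n power_deriv a k = ((n + k) ^_ n)%:R * a (n + k)%N.
Proof.
elim: n k => [|n IH] k; first by rewrite ffactn0 mul1r.
rewrite /= /power_deriv IH ffactnSr addnS.
rewrite (_ : (n + k).+1 - n = k.+1)%N; last by rewrite -addnS addKn.
by rewrite natrM addSn; ring.
Qed.

Lemma power_sum0 a : power_sum a 0 = a 0%N.
Proof.
apply: cvg_lim => //; rewrite -cvg_shiftS.
rewrite (_ : (fun n => _) = fun=> a 0%N); first exact: cvg_cst.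
apply/funext => n; rewrite /series /= big_nat_recl // expr0 mulr1 big1 ?addr0 //.
by move=> k _; rewrite expr0n mulr0.
Qed.

(** The [n]-th complex derivative of [f] is the sum of the [n]-th formal derivative
   on the whole disc; at [0] only its constant term [n`! * a n] survives. *)
Lemma taylor_power_sum a (f : C -> C) n : disc_summable a ->
  (forall w, normc w < 1 -> f w = power_sum a w) -> taylor f n = a n.
Proof.
move=> da fa.
have [_ iter_a] : disc_summable (iter n power_deriv a) /\ forall w, normc w < 1 ->
    derive1n n f w = power_sum (iter n power_deriv a) w.
  elim: n => [|n [dn IH]]; first by split.
  split; first exact: power_deriv_summable.
  by move=> w w1; rewrite /= (power_sum_derive dn IH).
rewrite /taylor iter_a ?normc0 // power_sum0 iter_power_deriv addn0 ffactnn.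
by rewrite mulrAC divff ?mul1r // pnatr_eq0 -lt0n fact_gt0.
Qed.

Lemma power_sum_analytic a (f : C -> C) : disc_summable a ->
  (forall w, normc w < 1 -> f w = power_sum a w) -> analytic_disc f.
Proof.
move=> da fa z; rewrite normc_lt1 => z1.
rewrite fa // (_ : (fun n => _) = (fun n => a n * z ^+ n)).
  exact: power_sum_cvg.
by apply/funext => n; rewrite (taylor_power_sum n da fa).
Qed.

End PowerSeries.

(** * Integration over a period and Parseval's identity *)

Section CircleIntegral.
Context {R : realType}.
Local Notation C := R[i].
Local Notation mu := (@lebesgue_measure R).
Implicit Types (f g : R -> C) (a b t : R) (z : C).

Lemma continuous_sqr (u : R -> R) : continuous u -> continuous (fun t => u t ^+ 2).
Proof.
move=> cu t; apply: (@continuous_comp _ _ _ u (fun x => x ^+ 2)); first exact: cu.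
exact: exprn_continuous.
Qed.

Definition cis t : C := circle_point 1 t.

Lemma cisE t : cis t = (cos t +i* sin t)%C.
Proof. by rewrite /cis /circle_point !mul1r. Qed.

Lemma circle_pointE (r t : R) : circle_point r t = r%:C%C * cis t.
Proof. by rewrite cisE /circle_point; simpc. Qed.

Lemma normc_cis t : normc (cis t) = 1.
Proof. by rewrite cisE /= cos2Dsin2 sqrtr1. Qed.

Lemma cisD t u : cis (t + u) = cis t * cis u.
Proof. by rewrite !cisE cosD sinD; simpc; congr Complex; rewrite addrC. Qed.

Lemma cisX t n : cis t ^+ n = cis (t *+ n).
Proof.
elim: n => [|n IH]; first by rewrite expr0 mulr0n cisE cos0 sin0.
by rewrite exprS IH -cisD -mulrS.
Qed.

Lemma cis_conjK t : cis t * (cis t)^* = 1.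
Proof. by rewrite normcJ normc_cis expr1n. Qed.

(** A record, lest unification unfold the topology of [C]. *)
Record ccontinuous f : Prop := CContinuous { ccontinuous_cvg : continuous f }.

Lemma continuous_cstc z : ccontinuous (fun _ : R => z).
Proof. by split=> t; exact: cvg_cst. Qed.

Lemma continuous_Re f : ccontinuous f -> continuous (fun t => Re (f t)).
Proof.
move=> [cf] t; have /cvg_normcP := cf t; set u := (X in X --> _) => uc.
apply/cvgrPdist_lt => e e0; have /cvgrPdist_lt/(_ e e0) := uc.
apply: filterS => x; rewrite sub0r normrN ger0_norm ?normc_ge0 // normcB.
apply: le_lt_trans; rewrite (le_trans _ (le_Re_normc _)) //.
by case: (f t) (f x) => ? ? [].
Qed.

Lemma continuous_Im f : ccontinuous f -> continuous (fun t => Im (f t)).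
Proof.
move=> [cf] t; have /cvg_normcP := cf t; set u := (X in X --> _) => uc.
apply/cvgrPdist_lt => e e0; have /cvgrPdist_lt/(_ e e0) := uc.
apply: filterS => x; rewrite sub0r normrN ger0_norm ?normc_ge0 // normcB.
apply: le_lt_trans; rewrite (le_trans _ (le_Im_normc _)) //.
by case: (f t) (f x) => ? ? [].
Qed.

Lemma continuous_ReIm (u v : R -> R) : continuous u -> continuous v ->
  ccontinuous (fun t => (u t +i* v t)%C).
Proof. by move=> cu cv; split=> t; apply: cvg_ReIm; [exact: cu|exact: cv]. Qed.

Lemma continuous_cis : ccontinuous cis.
Proof.
rewrite (_ : cis = fun t => (cos t +i* sin t)%C); last exact/funext/cisE.
by apply: continuous_ReIm; [exact: continuous_cos|exact: continuous_sin].
Qed.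


Lemma continuous_conj f : ccontinuous f -> ccontinuous (fun t => (f t)^*).
Proof.
move=> cf; rewrite (_ : (fun t => _) = fun t => (Re (f t) +i* - Im (f t))%C).
  apply: continuous_ReIm; first exact: continuous_Re.
  by move=> t; apply: cvgN; exact: continuous_Im.
by apply/funext => t; case: (f t).
Qed.


Lemma continuous_mulc f g : ccontinuous f -> ccontinuous g ->
  ccontinuous (fun t => f t * g t).
Proof. by move=> [cf] [cg]; split=> t; apply: cvgM; [exact: cf|exact: cg]. Qed.

Lemma continuous_addc f g : ccontinuous f -> ccontinuous g ->
  ccontinuous (fun t => f t + g t).
Proof. by move=> [cf] [cg]; split=> t; apply: cvgD; [exact: cf|exact: cg]. Qed.

Lemma continuous_cisX n : ccontinuous (fun t => cis t ^+ n).
Proof.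
elim: n => [|n IH].
  rewrite (_ : (fun t => _) = fun=> 1); first exact: continuous_cstc.
  by apply/funext => t; rewrite expr0.
rewrite (_ : (fun t => _) = fun t => cis t * cis t ^+ n); last first.
  by apply/funext => t; rewrite exprS.
exact: (continuous_mulc continuous_cis IH).
Qed.

Lemma continuous_csum n (F : nat -> R -> C) : (forall k, ccontinuous (F k)) ->
  ccontinuous (fun t => \sum_(k < n) F k t).
Proof.
move=> cF; elim: n => [|n IH].
  by under eq_fun do rewrite big_ord0; exact: continuous_cstc.
under eq_fun do rewrite big_ord_recr /=.
exact: (continuous_addc IH (cF n)).
Qed.

Lemma continuous_normc f : ccontinuous f -> continuous (fun t => normc (f t)).
Proof.
move=> cf; rewrite (_ : (fun t => _) =
    (fun t => Num.sqrt (Re (f t) ^+ 2 + Im (f t) ^+ 2))).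
  move=> t; apply: (@continuous_comp _ _ _
    (fun t => Re (f t) ^+ 2 + Im (f t) ^+ 2) Num.sqrt); last exact: sqrt_continuous.
  by apply: cvgD; apply: (continuous_sqr (_ : continuous _));
    [exact: continuous_Re|exact: continuous_Im].
by apply/funext => t; case: (f t).
Qed.

Lemma integrable_continuous a b (u : R -> R) : continuous u ->
  mu.-integrable `[a, b] (EFin \o u).
Proof.
move=> cu; apply: continuous_compact_integrable; first exact: segment_compact.
exact: continuous_subspaceT.
Qed.

Definition cint a f : C :=
  ((\int[mu]_(t in `[a, (a + pi *+ 2)%R]) Re (f t)) +i*
   (\int[mu]_(t in `[a, (a + pi *+ 2)%R]) Im (f t)))%C.

Lemma eq_cint a f g : f =1 g -> cint a f = cint a g.
Proof. by move=> /funext ->. Qed.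

Lemma cintD a f g : ccontinuous f -> ccontinuous g ->
  cint a (fun t => f t + g t) = cint a f + cint a g.
Proof.
move=> cf cg; rewrite /cint /=; apply/eqP; rewrite eq_complex /=.
have cR := continuous_Re; have cI := continuous_Im.
apply/andP; split; apply/eqP; rewrite -RintegralD //; try exact: integrable_continuous;
  try (apply: integrable_continuous; by [exact: cR|exact: cI]).
- by apply: eq_Rintegral => t _; case: (f t) (g t) => ? ? [].
- by apply: eq_Rintegral => t _; case: (f t) (g t) => ? ? [].
Qed.

Lemma cintZ a z f : ccontinuous f ->
  cint a (fun t => z * f t) = z * cint a f.
Proof.
move=> cf; have cR := continuous_Re cf; have cI := continuous_Im cf.
have cZ (r : R) (u : R -> R) : continuous u -> continuous (fun t => r * u t).
  by move=> cu t; apply: cvgM; [exact: cvg_cst|exact: cu].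
have ic u : continuous u -> mu.-integrable `[a, (a + pi *+ 2)%R] (EFin \o u).
  exact: integrable_continuous.
case: z => x y; rewrite /cint; apply/eqP; rewrite eq_complex /=.
apply/andP; split; apply/eqP.
- rewrite -!RintegralZl -?RintegralB ?ic //; try by apply: cZ.
  by apply: eq_Rintegral => t _; case: (f t).
- rewrite -!RintegralZl -?RintegralD ?ic //; try by apply: cZ.
  by apply: eq_Rintegral => t _; case: (f t).
Qed.

Lemma cint0 a : cint a (fun=> 0) = 0.
Proof.
rewrite (_ : (fun=> 0) = fun=> 0 * 0); last by rewrite mul0r.
by rewrite cintZ ?mul0r //; exact: continuous_cstc.
Qed.

Lemma cint_sum a n (F : nat -> R -> C) : (forall k, ccontinuous (F k)) ->
  cint a (fun t => \sum_(k < n) F k t) = \sum_(k < n) cint a (F k).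
Proof.
move=> cF; elim: n => [|n IH].
  by rewrite big_ord0; under eq_fun do rewrite big_ord0; exact: cint0.
rewrite big_ord_recr /= -IH -cintD //; last exact: continuous_csum.
by apply: eq_cint => t; rewrite big_ord_recr.
Qed.

Lemma cint_conj a f : ccontinuous f -> cint a (fun t => (f t)^*) = (cint a f)^*.
Proof.
move=> cf; rewrite /cint; apply/eqP; rewrite eq_complex /=; apply/andP; split.
  by apply/eqP; apply: eq_Rintegral => t _; case: (f t).
apply/eqP; rewrite -mulN1r -RintegralZl //; last first.
  by apply: integrable_continuous; exact: continuous_Im.
by apply: eq_Rintegral => t _; case: (f t) => ? ?; rewrite mulN1r.
Qed.

Lemma cint_cst a : cint a (fun=> 1) = (pi *+ 2)%:C%C.
Proof.
rewrite /cint /=; congr Complex; rewrite Rintegral_cst //= ?mul0r // mul1r.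
rewrite lebesgue_measure_itv /= lte_fin ltrDl mulrn_wgt0 ?pi_gt0 //.
by rewrite -EFinD addrAC subrr add0r.
Qed.

(** The real and imaginary parts have periodic antiderivatives. *)
Lemma cint_cisX a n : cint a (fun t => cis t ^+ n.+1) = 0.
Proof.
have FTC (F f : R -> R) : (forall t, is_derive t 1 F (f t)) -> continuous f ->
    F (a + pi *+ 2) = F a -> \int[mu]_(t in `[a, (a + pi *+ 2)%R]) f t = 0.
  move=> dF cf Fper.
  have a_lt : a < a + pi *+ 2 by rewrite ltrDl mulrn_wgt0 // pi_gt0.
  have cF : continuous F.
    move=> t; apply/differentiable_continuous/derivable1_diffP.
    by have := dF t => -[].
  rewrite /Rintegral (@continuous_FTC2 _ f F) // ?Fper ?subee //.
  - exact: continuous_subspaceT.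
  - split.
    + by move=> t _; have := dF t => -[].
    + by apply: cvg_at_right_filter; exact: cF.
    + by apply: cvg_at_left_filter; exact: cF.
  - by move=> t _; rewrite derive1E; have := dF t => -[].
have per (F : R -> R) (c : R) : periodic F (pi *+ 2) ->
    c * F ((a + pi *+ 2) *+ n.+1) = c * F (a *+ n.+1).
  by move=> pF; rewrite mulrnDl (periodicn pF).
have dn (t : R) : is_derive t 1 (fun t : R => t *+ n.+1) n.+1%:R.
  rewrite (_ : (fun _ => _) = (n.+1%:R *: (@id R))); last first.
    by apply/funext => u; exact/esym/(mulr_natl u n.+1).
  by apply: is_derive_eq; rewrite /GRing.scale /= mulr1.
have cn : continuous (fun t : R => t *+ n.+1).
  move=> t; apply/differentiable_continuous/derivable1_diffP.
  by have := dn t => -[].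
have n0 : n.+1%:R != 0 :> R by rewrite pnatr_eq0.
rewrite /cint (_ : (fun _ => _) = fun t => cos (t *+ n.+1)); last first.
  by apply/funext => t; rewrite cisX cisE.
rewrite (_ : (fun t => Im _) = fun t => sin (t *+ n.+1)); last first.
  by apply/funext => t; rewrite cisX cisE.
rewrite -[RHS]/((0 : R) +i* 0)%C; congr Complex.
- apply: (FTC (fun t => n.+1%:R^-1 * sin (t *+ n.+1))) => [t|t|].
  + have := @is_derive1_comp R sin (fun t => t *+ n.+1) t _ _ (is_derive_sin _) (dn t).
    move=> /(is_deriveZ n.+1%:R^-1) h; apply: is_derive_eq.
    by rewrite /GRing.scale /= mulrCA mulVf // mulr1.
  + apply: (@continuous_comp _ _ _ (fun t : R => t *+ n.+1) cos); first exact: cn.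
    exact: continuous_cos.
  + exact/per/sinD2pi.
- apply: (FTC (fun t => - n.+1%:R^-1 * cos (t *+ n.+1))) => [t|t|].
  + have := @is_derive1_comp R cos (fun t => t *+ n.+1) t _ _ (is_derive_cos _) (dn t).
    move=> /(is_deriveZ (- n.+1%:R^-1)) h; apply: is_derive_eq.
    by rewrite /GRing.scale /= mulNr mulrCA mulVf // mulr1 opprK.
  + apply: (@continuous_comp _ _ _ (fun t : R => t *+ n.+1) sin); first exact: cn.
    exact: continuous_sin.
  + exact/per/cosD2pi.
Qed.

Lemma cint_cis_orth a j k : cint a (fun t => cis t ^+ j * (cis t ^+ k)^*) =
  if j == k then (pi *+ 2)%:C%C else 0.
Proof.
have red t i l : cis t ^+ (i + l) * (cis t ^+ i)^* = cis t ^+ l.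
  by rewrite exprD mulrAC rmorphXn /= -exprMn cis_conjK expr1n mul1r.
case: (ltngtP j k) => [jk|kj|->].
- rewrite (@eq_cint a _ (fun t => (cis t ^+ (k - j))^*)); last first.
    move=> t; rewrite -(red t j (k - j)%N) subnKC ?(ltnW jk) // rmorphM /= conjCK.
    by rewrite mulrC.
  rewrite cint_conj; last exact: continuous_cisX.
  by rewrite -(prednK (_ : 0 < k - j)%N) ?subn_gt0 // cint_cisX conjC0.
- rewrite (@eq_cint a _ (fun t => cis t ^+ (j - k))); last first.
    by move=> t; rewrite -(red t k (j - k)%N) subnKC // ltnW.
  by rewrite -(prednK (_ : 0 < j - k)%N) ?subn_gt0 // cint_cisX.
- rewrite -(cint_cst a); apply: eq_cint => t.
  by rewrite -{1}(addn0 k) red expr0.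
Qed.

(** Parseval's identity for polynomials: expand the square of the modulus as a double
   sum and use the orthogonality of the powers of [cis]. *)
Lemma integral_sqr_poly a (c : C ^nat) n :
  (\int[mu]_(t in `[a, (a + pi *+ 2)%R])
     (normc (\sum_(k < n) c k * cis t ^+ k) ^+ 2)%:E =
   (pi *+ 2 * \sum_(k < n) normc (c k) ^+ 2)%:E)%E.
Proof.
set g := fun t => \sum_(k < n) c k * cis t ^+ k.
have cck k : ccontinuous (fun t => c k * cis t ^+ k).
  exact: (continuous_mulc (continuous_cstc _) (continuous_cisX k)).
have cg : ccontinuous g := continuous_csum n cck.
have cg2 : continuous (fun t => normc (g t) ^+ 2).
  by apply: continuous_sqr; exact: continuous_normc.
have E : cint a (fun t => g t * (g t)^*) = (pi *+ 2 * \sum_(k < n) normc (c k) ^+ 2)%:C%C.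
  pose F j t := \sum_(k < n) (c j * (c k)^*) * (cis t ^+ j * (cis t ^+ k)^*).
  have cjk j k : ccontinuous (fun t => (cis t ^+ j * (cis t ^+ k)^*)).
    exact: (continuous_mulc (continuous_cisX j) (continuous_conj (continuous_cisX k))).
  have cjk' j k : ccontinuous (fun t => (c j * (c k)^*) * (cis t ^+ j * (cis t ^+ k)^*)).
    exact: (continuous_mulc (continuous_cstc _) (cjk j k)).
  rewrite (@eq_cint a _ (fun t => \sum_(j < n) F j t)); last first.
    move=> t; rewrite /g rmorph_sum /= mulr_suml; apply: eq_bigr => j _.
    rewrite mulr_sumr; apply: eq_bigr => k _; rewrite rmorphM /=; ring.
  rewrite cint_sum; last first.
    by move=> j; exact: (continuous_csum n (cjk' j)).
  rewrite mulr_sumr rmorph_sum /=; apply: eq_bigr => j _.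
  rewrite /F (cint_sum a n (cjk' j)).
  rewrite (bigD1 j) //= (cintZ _ _ (cjk j j)) cint_cis_orth eqxx normcJ big1 ?addr0.
    by rewrite mulrC -rmorphM.
  by move=> k kj; rewrite (cintZ _ _ (cjk j k)) cint_cis_orth eq_sym val_eqE (negPf kj) mulr0.
have := congr1 (@complex.Re R) E; rewrite /cint /= => <-.
rewrite /Rintegral fineK; first by apply: eq_integral => t _; rewrite normcJ.
apply: integrable_fin_num => //.
rewrite (_ : (fun x => _) = EFin \o (fun t => normc (g t) ^+ 2)).
  exact: integrable_continuous.
by apply/funext => t; rewrite normcJ.
Qed.

End CircleIntegral.

(** * Square summable coefficients and [H^2] *)

Section HardySpace.
Context {R : realType}.
Local Notation C := R[i].
Local Notation mu := (@lebesgue_measure R).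
Implicit Types (a : C ^nat) (z : C) (f : C -> C).

Definition l2_coef a := exists B : R, forall n, \sum_(k < n) normc (a k) ^+ 2 <= B.

Lemma geometric_sum_le (r : R) n : 0 <= r -> r < 1 ->
  \sum_(k < n) r ^+ k <= (1 - r)^-1.
Proof.
move=> r0 r1; have r1' : 0 < 1 - r by rewrite subr_gt0.
rewrite -[leRHS]mul1r ler_pdivlMr // mulrC.
by rewrite -opprB mulNr -subrX1 opprB gerBl exprn_ge0.
Qed.

Lemma bounded_coef_summable a (c : R) : (forall k, normc (a k) <= c) ->
  disc_summable a.
Proof.
move=> ac r r0 r1; have c0 : 0 <= c := le_trans (normc_ge0 _) (ac 0%N).
exists (c * (1 - r)^-1) => n.
apply: le_trans (ler_wpM2l c0 (geometric_sum_le n r0 r1)); rewrite mulr_sumr.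
by apply: ler_sum => k _; rewrite ler_wpM2r ?exprn_ge0.
Qed.

Lemma l2_coef_summable a : l2_coef a -> disc_summable a.
Proof.
move=> [B aB]; apply: (@bounded_coef_summable _ (1 + B)) => k.
have := aB k.+1; rewrite big_ord_recr /= => aBk.
have s0 : 0 <= \sum_(i < k) normc (a i) ^+ 2 by rewrite sumr_ge0 // => i _; rewrite sqr_ge0.
have : normc (a k) <= 1 + normc (a k) ^+ 2 by have := normc_ge0 (a k); nra.
lra.
Qed.

(** Parseval's identity bounds the integrals of the partial sums uniformly in the
   radius, and Fatou's lemma carries the bound over to the limit. *)
Lemma power_sum_hardy_2 a f : l2_coef a ->
  (forall z, normc z < 1 -> f z = power_sum a z) -> hardy_2 f.
Proof.
move=> la fa; have da := l2_coef_summable la; have [B aB] := la.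
split; first exact: (power_sum_analytic da fa).
exists (pi *+ 2 * B) => r /andP[r0 r1].
pose g n t := (normc (\sum_(k < n) (a k * r%:C%C ^+ k) * cis t ^+ k) ^+ 2)%:E.
have ng t n : series (fun k => a k * circle_point r t ^+ k) n =
    \sum_(k < n) (a k * r%:C%C ^+ k) * cis t ^+ k.
  rewrite /series /= big_mkord; apply: eq_bigr => k _.
  by rewrite circle_pointE exprMn mulrA.
have cg n : continuous (fun t => normc (\sum_(k < n) (a k * r%:C%C ^+ k) * cis t ^+ k) ^+ 2).
  apply: continuous_sqr; apply: continuous_normc.
  exact: (continuous_csum n (fun k =>
    continuous_mulc (continuous_cstc (a k * r%:C%C ^+ k)) (continuous_cisX k))).
have fE t : (normc (f (circle_point r t)) ^+ 2)%:E = limn_einf (g ^~ t).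
  have nz1 : normc (circle_point r t) < 1.
    by rewrite circle_pointE normcM normc_cis mulr1 normc_real ger0_norm.
  have /cvg_limn_einf_sup[-> //] : g ^~ t @ \oo --> (normc (f (circle_point r t)) ^+ 2)%:E.
  apply: cvg_EFin; first exact: nearW.
  have /cvg_normcP h := power_sum_cvg da nz1; rewrite -fa // in h.
  have : normc (series (fun k => a k * circle_point r t ^+ k) n) @[n --> \oo] -->
      normc (f (circle_point r t)).
    apply/cvgrPdist_le => e e0; have /cvgrPdist_le/(_ e e0) := h.
    apply: filterS => n; rewrite sub0r normrN ger0_norm ?normc_ge0 //.
    set u := series _ _; set v := f _; apply: le_trans.
    have := le_normcD (u - v) v; have := le_normcD (v - u) u.
    by rewrite !subrK (normcB v u) ler_norml => h1 h2; apply/andP; split; lra.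
  move=> c; rewrite expr2.
  under eq_cvg do rewrite /= -ng expr2.
  exact: cvgM.
under eq_integral do rewrite fE.
have mD : measurable (`[0%R, (2 * pi)%R]%classic : set R) by [].
apply: (le_trans (fatou mu mD _ _)).
- move=> n; apply/measurable_EFinP; apply: measurable_funTS.
  exact: continuous_measurable_fun.
- by move=> n t _; rewrite lee_fin sqr_ge0.
rewrite limn_einf_lim; apply: lime_le; first exact: is_cvg_einfs.
apply: nearW => n; apply: (@le_trans _ _ (\int[mu]_(t in `[0%R, (2 * pi)%R]) g n t)%E).
  by apply: ereal_inf_lbound; exists n => //=.
rewrite mulr_natl (_ : (\int[mu]_(t in _) _ = (pi *+ 2 *
    \sum_(k < n) normc (a k * r%:C%C ^+ k) ^+ 2)%:E)%E); last first.
  by have := integral_sqr_poly 0 (fun k => a k * r%:C%C ^+ k) n; rewrite add0r.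
rewrite lee_fin ler_wpM2l ?(mulrn_wge0 _ (pi_ge0 R)) //.
apply: le_trans (aB n); apply: ler_sum => k _.
rewrite normcM normcX normc_real ger0_norm // lerXn2r ?nnegrE ?normc_ge0 //.
  by rewrite mulr_ge0 ?normc_ge0 ?exprn_ge0.
by rewrite ler_piMr ?normc_ge0 // exprn_ile1 // ltW.
Qed.

End HardySpace.

(** * Poisson's formula for polynomials *)

Section PoissonFormula.
Context {R : realType}.
Local Notation C := R[i].
Local Notation mu := (@lebesgue_measure R).
Implicit Types (a t : R) (z : C).

Definition poly_sum (c : C ^nat) n z : C := \sum_(k < n) c k * z ^+ k.

Lemma continuous_poly_cis (c : C ^nat) n : ccontinuous (fun t => poly_sum c n (cis t)).
Proof.
exact: (continuous_csum n (fun k =>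
  continuous_mulc (continuous_cstc (c k)) (continuous_cisX k))).
Qed.

Lemma continuous_real_complex (u : R -> R) : continuous u ->
  ccontinuous (fun t => (u t)%:C%C).
Proof. by move=> cu; apply: continuous_ReIm => // t; exact: cvg_cst. Qed.

(** Multiplying [f] by the conjugate of its integral makes the integral real, hence
   equal to the integral of a real part. *)
Lemma normc_cint a (f : R -> C) : ccontinuous f ->
  normc (cint a f) <= \int[mu]_(t in `[a, (a + pi *+ 2)%R]) normc (f t).
Proof.
move=> cf; set w := cint a f; set I := (X in _ <= X).
have I0 : 0 <= I by apply: Rintegral_ge0 => t _; exact: normc_ge0.
have [w0|w_neq0] := eqVneq (normc w) 0; first by rewrite w0.
have w_gt0 : 0 < normc w by rewrite lt_def w_neq0 normc_ge0.
rewrite -(ler_pM2l w_gt0).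
have cwf : ccontinuous (fun t => w^* * f t).
  exact: (continuous_mulc (continuous_cstc _) cf).
have -> : normc w * normc w =
    \int[mu]_(t in `[a, (a + pi *+ 2)%R]) Re (w^* * f t).
  have := cintZ a w^* cf; rewrite -/w mulrC normcJ => /(congr1 (@complex.Re R)).
  by rewrite /cint /= expr2 => <-.
rewrite /I -RintegralZl //; last first.
  by apply: integrable_continuous; exact: continuous_normc.
apply: le_Rintegral => //.
- by apply: integrable_continuous; exact: continuous_Re.
- apply: integrable_continuous => t; apply: cvgM; first exact: cvg_cst.
  exact: continuous_normc.
- move=> t _; rewrite -(normc_conj w) -normcM.
  by rewrite (le_trans (ler_norm _)) // le_Re_normc.
Qed.

Definition poisson z t : R := (1 - normc z ^+ 2) / normc (cis t - z) ^+ 2.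

Lemma normc_cisB_ge z t : 1 - normc z <= normc (cis t - z).
Proof.
by rewrite lerBlDr -(normc_cis t) -{1}(subrK z (cis t)) le_normcD.
Qed.

Lemma normc_cisB_gt0 z t : normc z < 1 -> 0 < normc (cis t - z).
Proof. by move=> z1; apply: lt_le_trans (normc_cisB_ge z t); rewrite subr_gt0. Qed.

Lemma poisson_ge0 z t : normc z < 1 -> 0 <= poisson z t.
Proof.
move=> z1; rewrite divr_ge0 ?sqr_ge0 // subr_ge0.
by rewrite exprn_ile1 ?normc_ge0 // ltW.
Qed.

Lemma poisson_le z t : normc z < 1 -> poisson z t <= 2 / (1 - normc z).
Proof.
move=> z1; have d0 : 0 < 1 - normc z by rewrite subr_gt0.
have D0 := normc_cisB_gt0 t z1.
rewrite ler_pdivrMr ?exprn_gt0 // mulrAC ler_pdivlMr //.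
have := normc_cisB_ge z t; have := normc_ge0 z.
set x := normc z in z1 d0 *; set y := normc _ in D0 * => x0 xy.
have : (1 - x) ^+ 2 <= y ^+ 2 by rewrite ler_sqr ?nnegrE ?(ltW d0) ?(ltW D0).
have : 0 <= (1 - x) ^+ 2 * (1 - x) by rewrite mulr_ge0 ?sqr_ge0 ?(ltW d0).
rewrite !expr2; nra.
Qed.

Lemma continuous_poisson z : normc z < 1 -> continuous (poisson z).
Proof.
move=> z1 t; apply: cvgM; first exact: cvg_cst.
apply: cvgV; first by rewrite gt_eqF // exprn_gt0 // normc_cisB_gt0.
move: t; apply: continuous_sqr; apply: continuous_normc.
exact: (continuous_addc continuous_cis (continuous_cstc (- z))).
Qed.

(** Poisson's kernel with the denominator cleared: the first factor on the left is
   [normc (cis t - z) ^+ 2]. *)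
Lemma poissonE z t : normc z < 1 ->
  (1 + z * z^* - z^* * cis t - z * (cis t)^*) * (poisson z t)%:C%C =
  1 - z * z^*.
Proof.
move=> z1; have D0 : normc (cis t - z) ^+ 2 != 0.
  by rewrite gt_eqF // exprn_gt0 // normc_cisB_gt0.
rewrite (_ : 1 + _ - _ - _ = (normc (cis t - z) ^+ 2)%:C%C); last first.
  rewrite -normcJ rmorphB /= mulrBl !mulrBr cis_conjK; ring.
rewrite -rmorphM /= /poisson mulrC divfK //.
by rewrite rmorphB /= rmorph1 normcJ.
Qed.

Section Moments.
Variables (a : R) (z : C).
Hypothesis z1 : normc z < 1.

Let P t : C := (poisson z t)%:C%C.
Let J n := cint a (fun t => cis t ^+ n * P t).

Let cP : ccontinuous P.
Proof. by apply: continuous_real_complex; exact: continuous_poisson. Qed.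

Let cJ n : ccontinuous (fun t => cis t ^+ n * P t).
Proof. exact: (continuous_mulc (continuous_cisX n) cP). Qed.

Let J_bound n : normc (J n) <= \int[mu]_(t in `[a, (a + pi *+ 2)%R]) poisson z t.
Proof.
apply: le_trans (normc_cint a (cJ n)) _; rewrite le_eqVlt; apply/orP; left.
apply/eqP; apply: eq_Rintegral => t _.
by rewrite normcM normcX normc_cis expr1n mul1r normc_real ger0_norm ?poisson_ge0.
Qed.

Let J_rec n : J n.+1 - z * J n = z^* * (J n.+2 - z * J n.+1).
Proof.
suff : (1 + z * z^*) * J n.+1 + (- z^*) * J n.+2 + (- z) * J n = 0.
  by move=> h; apply/eqP; rewrite -subr_eq0; apply/eqP; rewrite -[RHS]h; ring.
have cZ (w : C) k := continuous_mulc (continuous_cstc w) (cJ k).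
rewrite /J -!(cintZ a _ (cJ _)) -(cintD _ (cZ _ _) (cZ _ _)).
rewrite -(cintD _ (continuous_addc (cZ _ _) (cZ _ _)) (cZ _ _)).
rewrite (@eq_cint _ a _ (fun t => (1 - z * z^*) * cis t ^+ n.+1)).
  by rewrite (cintZ _ _ (continuous_cisX _)) cint_cisX mulr0.
move=> t; rewrite -(poissonE t z1) -/(P t) !exprSr.
transitivity (cis t ^+ n * P t * ((1 + z * z^*) * cis t - z^* * (cis t * cis t)
  - z * 1)); first by ring.
by rewrite -(cis_conjK t); ring.
Qed.

Let J_succ n : J n.+1 = z * J n.
Proof.
apply/eqP; rewrite -subr_eq0; apply/eqP/eq0_normc.
set M := \int[mu]_(t in `[a, (a + pi *+ 2)%R]) poisson z t.
have dk k : J n.+1 - z * J n = z^* ^+ k * (J (n + k).+1 - z * J (n + k)%N).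
  elim: k => [|k ->]; first by rewrite expr0 mul1r addn0.
  by rewrite addnS exprSr -mulrA -(J_rec (n + k)).
have bd k : normc (J n.+1 - z * J n) <= normc z ^+ k * (2 * M).
  rewrite (dk k) normcM normcX normc_conj ler_wpM2l ?exprn_ge0 ?normc_ge0 //.
  rewrite (le_trans (le_normcD _ _)) // normcN normcM mulr_natl mulr2n lerD ?J_bound //.
  by rewrite (le_trans _ (J_bound (n + k))) // ler_piMl ?normc_ge0 // ltW.
apply/eqP; rewrite eq_le normc_ge0 andbT.
have c0 : normc z ^+ k * (2 * M) @[k --> \oo] --> 0.
  rewrite -(mul0r (2 * M)); apply: cvgM; last exact: cvg_cst.
  by apply: cvg_expr; rewrite ger0_norm ?normc_ge0.
by apply: (cvgr_to_ge c0); apply: nearW => k; exact: bd.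
Qed.

(** Integrating [poissonE] against [cis t ^+ n.+1] gives a three-term recursion for
   the moments [J].  It says that [d n := J n.+1 - z * J n] equals [z^* * d n.+1], hence
   [z^* ^+ k * d (n + k)] for all [k].  The moments are bounded, so [d n = 0], and the
   moments form a geometric progression.  Its first term comes from the recursion at
   index [0], where [J (-1)] is the conjugate of [J 1]. *)
Lemma poisson_moment n : J n = (pi *+ 2)%:C%C * z ^+ n.
Proof.
elim: n => [|n IH]; last by rewrite J_succ IH exprS; ring.
rewrite expr0 mulr1.
have J1c : cint a (fun t => (cis t)^* * P t) = (J 1)^*.
  rewrite /J -(cint_conj _ (cJ 1)); apply: eq_cint => t.
  by rewrite expr1 rmorphM /= /P; congr (_ * _); rewrite conj_real_complex.
have J0c : (J 0)^* = J 0.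
  rewrite /J -(cint_conj _ (cJ 0)); apply: eq_cint => t.
  by rewrite expr0 !mul1r /P conj_real_complex.
have cc1 := continuous_mulc (continuous_conj continuous_cis) cP.
have cZ (w : C) k := continuous_mulc (continuous_cstc w) (cJ k).
have E : (1 + z * z^*) * J 0 + (- z^*) * J 1 + (- z) * (J 1)^* =
    (1 - z * z^*) * (pi *+ 2)%:C%C.
  rewrite -J1c -(cint_cst a) /J -(cintZ _ _ (continuous_cstc 1)).
  rewrite -!(cintZ a _ (cJ _)) -(cintZ _ _ cc1) -(cintD _ (cZ _ _) (cZ _ _)).
  rewrite -(cintD _ (continuous_addc (cZ _ _) (cZ _ _))
    (continuous_mulc (continuous_cstc _) cc1)).
  by apply: eq_cint => t; rewrite -(poissonE t z1) -/(P t) expr0 expr1; ring.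
have zz : 1 - z * z^* != 0.
  rewrite normcJ -(rmorph1 (real_complex R)) -rmorphB; apply/eqP => /complexI/eqP.
  by rewrite gt_eqF // subr_gt0 expr_lt1 ?normc_ge0.
apply: (mulfI zz); rewrite -E J_succ rmorphM /= J0c; ring.
Qed.

End Moments.

Lemma poisson_formula a z (c : C ^nat) n : normc z < 1 ->
  cint a (fun t => poly_sum c n (cis t) * (poisson z t)%:C%C) =
  (pi *+ 2)%:C%C * poly_sum c n z.
Proof.
move=> z1.
have cP := continuous_real_complex (continuous_poisson z1).
have cJ k := continuous_mulc (continuous_cisX k) cP.
rewrite (@eq_cint _ a _ (fun t => \sum_(k < n)
    c k * (cis t ^+ k * (poisson z t)%:C%C))); last first.
  by move=> t; rewrite mulr_suml; apply: eq_bigr => k _; rewrite mulrA.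
rewrite (cint_sum a n (fun k => continuous_mulc (continuous_cstc (c k)) (cJ k))).
rewrite mulr_sumr; apply: eq_bigr => k _; rewrite (cintZ _ _ (cJ k)).
by rewrite poisson_moment // mulrCA.
Qed.

Lemma poisson_bound a z (c : C ^nat) n : normc z < 1 ->
  ((pi *+ 2 * normc (poly_sum c n z))%:E <=
   \int[mu]_(t in `[a, (a + pi *+ 2)%R])
     (normc (poly_sum c n (cis t)) * poisson z t)%:E)%E.
Proof.
move=> z1.
have cP := continuous_real_complex (continuous_poisson z1).
have cgP := continuous_mulc (continuous_poly_cis c n) cP.
have := normc_cint a cgP; rewrite (poisson_formula a c n z1) normcM normc_real.
rewrite ger0_norm ?(mulrn_wge0 _ (pi_ge0 R)) // -lee_fin => /le_trans; apply.
rewrite /Rintegral fineK.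
  rewrite le_eqVlt; apply/orP; left; apply/eqP; apply: eq_integral => t _.
  by rewrite normcM normc_real ger0_norm ?poisson_ge0.
apply: integrable_fin_num => //; apply: integrable_continuous.
exact: continuous_normc.
Qed.

End PoissonFormula.

(** * Nontangential bounds by the Hardy-Littlewood maximal function *)

Section MaximalEstimate.
Context {R : realType}.
Local Notation C := R[i].
Local Notation mu := (@lebesgue_measure R).
Implicit Types (a t s : R) (z : C).

(** The difference of the two sides has derivative [x * sin x]. *)
Lemma sin_ge_xcos (x : R) : 0 <= x <= pi / 2 -> x * cos x <= sin x.
Proof.
move=> /andP[x0 xpi].
pose f (y : R) := sin y - y * cos y.
have df (y : R) : is_derive y 1 f (y * sin y).
  by apply: is_derive_eq; rewrite /GRing.scale /=; ring.
have cf : continuous f.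
  move=> y; apply/differentiable_continuous/derivable1_diffP.
  by have := df y => -[].
have : f 0 <= f x.
  apply: (@ger0_derive1_le_cc _ f 0 (pi / 2)) => //.
  - move=> y; rewrite in_itv /= => /andP[y0 ypi].
    rewrite derive1E; have [_ ->] := df y; rewrite mulr_ge0 ?(ltW y0) //.
    by apply/ltW/sin_gt0_pihalf; rewrite y0 ypi.
  - exact: continuous_subspaceT.
  - by rewrite in_itv /= lexx divr_ge0 ?pi_ge0.
  - by rewrite in_itv /= x0.
by rewrite /f sin0 mul0r subr0 subr_ge0.
Qed.

(** A chord is at least half as long as its arc.  Doubling the angle [`|s| / 4] twice
   reduces this to [sin_ge_xcos] on [[0, pi / 4]], where [2 * cos y ^+ 2 >= 1]. *)
Lemma chord_ge s : `|s| <= pi -> `|s| / 2 <= normc (cis s - 1).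
Proof.
move=> spi; set y := `|s| / 4.
have y0 : 0 <= y by rewrite divr_ge0.
have ypi : y <= pi / 4 by rewrite ler_pM2r.
have pi0 := pi_gt0 R.
have E : normc (cis s - 1) ^+ 2 = 16 * (sin y ^+ 2 * cos y ^+ 2).
  have -> : normc (cis s - 1) ^+ 2 = 2 - 2 * cos `|s|.
    have -> : cos `|s| = cos s.
      by case: (ltP s 0) => s0; rewrite ?(ltr0_norm s0) ?(ger0_norm s0) ?cosN.
    rewrite sqr_normcE cisE /= oppr0 addr0.
    have := cos2Dsin2 s; move: (cos s) (sin s) => c d; rewrite !expr2; lra.
  have -> : `|s| = (y *+ 2) *+ 2 by rewrite /y -mulrnA -mulr_natr; field.
  rewrite !cos_mulr2n.
  have := cos2Dsin2 y; move: (cos y) (sin y) => c d cd.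
  have dd : d ^+ 2 = 1 - c ^+ 2 by lra.
  by rewrite dd; ring.
have sy : y * cos y <= sin y by apply: sin_ge_xcos; rewrite y0 /=; lra.
have cy0 : 0 <= cos y by apply: cos_ge0_pihalf; apply/andP; split; lra.
have cy : 1 <= 2 * cos y ^+ 2.
  have := @cos_ge0_pihalf R (y *+ 2); rewrite cos_mulr2n -mulr_natl => h.
  have {}h : 0 <= 2 * cos y ^+ 2 - 1.
    rewrite mulr_natl; apply: h; rewrite mulr_natl; apply/andP; split; lra.
  lra.
rewrite -ler_sqr ?nnegrE ?normc_ge0 ?divr_ge0 // E.
have -> : `|s| = 4 * y by rewrite /y; field.
have h1 : (y * cos y) ^+ 2 <= sin y ^+ 2.
  by rewrite ler_sqr ?nnegrE ?mulr_ge0 // (le_trans _ sy) ?mulr_ge0.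
rewrite exprMn in h1.
have h2 : y ^+ 2 * cos y ^+ 2 * cos y ^+ 2 <= sin y ^+ 2 * cos y ^+ 2.
  by rewrite ler_wpM2r ?sqr_ge0.
have h3 : y ^+ 2 * 1 <= y ^+ 2 * (2 * cos y ^+ 2) ^+ 2.
  by rewrite ler_wpM2l ?sqr_ge0 // exprn_ege1.
have -> : (4 * y / 2) ^+ 2 = 4 * y ^+ 2 by field.
apply: (@le_trans _ _ (16 * (y ^+ 2 * cos y ^+ 2 * cos y ^+ 2))).
  rewrite (_ : 16 * _ = 4 * (y ^+ 2 * (2 * cos y ^+ 2) ^+ 2)); last by ring.
  by rewrite ler_pM2l //; move: h3; rewrite mulr1.
by rewrite ler_pM2l.
Qed.

Section Kernel.
Variables (alpha t0 : R) (z : C).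
Hypothesis z1 : normc z < 1.
Hypothesis zS : normc (z - cis t0) < alpha * (1 - normc z).

Let d := 1 - normc z.
Let d0 : 0 < d. Proof. by rewrite subr_gt0. Qed.
Let A := 1 + alpha.
Let A1 : 1 <= A.
Proof.
rewrite lerDl -(pmulr_lge0 _ d0).
by rewrite (le_trans (normc_ge0 (z - cis t0))) // ltW.
Qed.

Let chord_le t : normc (cis t - cis t0) <= A * normc (cis t - z).
Proof.
rewrite -(subrK z (cis t)) -addrA (le_trans (le_normcD _ _)) //.
rewrite subrK mulrDl mul1r lerD2l (le_trans (ltW zS)) // ler_wpM2l ?normc_cisB_ge //.
by rewrite -(lerD2l 1) addr0; exact: A1.
Qed.

(** In the Stolz region with vertex [cis t0], the distance from [z] to [cis t] controls
   the distance from the vertex to [cis t], hence the length of the arc. *)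
Lemma poisson_decay t : `|t - t0| <= pi -> t != t0 ->
  poisson z t <= 8 * A ^+ 2 * d / (t - t0) ^+ 2.
Proof.
move=> tpi tt0.
have s0 : 0 < (t - t0) ^+ 2 by rewrite exprn_even_gt0 //= subr_eq0.
have D0 := normc_cisB_gt0 t z1.
have h : `|t - t0| / 2 <= A * normc (cis t - z).
  apply: le_trans (chord_le t).
  have -> : cis t - cis t0 = cis t0 * (cis (t - t0) - 1).
    by rewrite mulrBr mulr1 -cisD [t0 + _]addrC subrK.
  by rewrite normcM normc_cis mul1r chord_ge.
have h2 : (t - t0) ^+ 2 <= 4 * A ^+ 2 * normc (cis t - z) ^+ 2.
  have := h; rewrite -ler_sqr ?nnegrE ?divr_ge0 ?mulr_ge0 ?(ltW D0) ?(le_trans ler01 A1) //.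
  rewrite exprMn exprVn real_normK ?num_real // exprMn => {}h.
  rewrite -mulrA -ler_pdivrMl //; apply: le_trans h.
  by rewrite le_eqVlt; apply/orP; left; apply/eqP; field.
rewrite /poisson ler_pdivrMr ?exprn_gt0 // mulrAC ler_pdivlMr //.
have pd : 1 - normc z ^+ 2 <= 2 * d.
  by have := normc_ge0 z; rewrite /d; move: z1; move: (normc z) => x; nra.
apply: (@le_trans _ _ (2 * d * (t - t0) ^+ 2)); first by rewrite ler_wpM2r ?(ltW s0).
have : 2 * d * (t - t0) ^+ 2 <= 2 * d * (4 * A ^+ 2 * normc (cis t - z) ^+ 2).
  by rewrite ler_wpM2l // mulr_ge0 // (ltW d0).
by move=> /le_trans; apply; rewrite le_eqVlt; apply/orP; left; apply/eqP; ring.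
Qed.

Let c k : R := 32 * A ^+ 2 / d * 4^-1 ^+ k.

Let c_ge0 k : 0 <= c k.
Proof.
apply: mulr_ge0; last by rewrite exprn_ge0 // invr_ge0.
by apply: divr_ge0; [apply: mulr_ge0; rewrite ?sqr_ge0|exact: ltW].
Qed.

(** The kernel is at most [c k] on the [k]-th dyadic arc around [t0] that is not yet
   covered by the previous one.  The arc has length [2 * 2 ^+ k * d] and
   [c k] is of order [4 ^- k / d], so the products of the two form a summable
   sequence that does not depend on [d]. *)
Lemma poisson_dyadic t K : `|t - t0| <= pi -> `|t - t0| < 2 ^+ K * d ->
  exists2 k : nat, (k <= K)%N & `|t - t0| < 2 ^+ k * d /\ poisson z t <= c k.
Proof.
move=> tpi; elim: K => [|K IH] tK.
  exists 0%N => //; split => //; rewrite /c expr0 mulr1.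
  apply: le_trans (poisson_le t z1) _; rewrite -/d ler_pM2r ?invr_gt0 //.
  by rewrite -[leLHS]mulr1 ler_pM // ?exprn_ege1 // ler_nat.
have [/IH[k kK h]|tK'] := ltP `|t - t0| (2 ^+ K * d).
  by exists k => //; exact: leqW.
exists K.+1 => //; split => //.
have p0 : 0 < 2 ^+ K * d by rewrite mulr_gt0 ?exprn_gt0.
have s0 : 0 < `|t - t0| := lt_le_trans p0 tK'.
apply: le_trans (poisson_decay tpi _) _; first by rewrite -subr_eq0 -normr_gt0.
rewrite -(real_normK (num_real (t - t0))) ler_pdivrMr ?exprn_gt0 //.
have A0 : 0 < A := lt_le_trans ltr01 A1.
apply: (@le_trans _ _ (c K.+1 * (2 ^+ K * d) ^+ 2)); last first.
  by rewrite ler_wpM2l ?c_ge0 // ler_sqr ?nnegrE ?(ltW p0) ?(ltW s0).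
rewrite le_eqVlt; apply/orP; left; apply/eqP.
have e : 4^-1 ^+ K * (2 ^+ K) ^+ 2 = 1 :> R.
  by rewrite exprAC -exprMn -natrX mulVf ?expr1n.
transitivity (8 * A ^+ 2 * d * (4^-1 ^+ K * (2 ^+ K) ^+ 2)).
  by rewrite e mulr1.
by rewrite /c [4^-1 ^+ K.+1]exprS; field; rewrite gt_eqF.
Qed.

(** The average of [h] over each dyadic arc is at most its maximal function.  The
   functions [b] and [h] differ because the maximal function on the line is applied to
   a periodic function [b] truncated to a bounded interval. *)
Lemma maximal_bound (h : R -> R) (l : R) (b : R -> R) :
  measurable_fun setT h -> (forall t, 0 <= h t) -> 0 <= l -> continuous b ->
  (HL_maximal h t0 <= l%:E)%E ->
  (forall t, `|t - t0| <= pi -> b t = h t) ->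
  (\int[mu]_(t in `[(t0 - pi)%R, (t0 - pi + pi *+ 2)%R])
      (b t * poisson z t)%:E <= (128 * A ^+ 2 * l)%:E)%E.
Proof.
move=> mh h0 l0 cb hl bh.
have [K piK] : exists K, pi < 2 ^+ K * d.
  exists (Num.truncn (pi / d)).+1; rewrite -ltr_pdivrMr //.
  apply: lt_trans (truncnS_gt _) _.
  by rewrite -natrX ltr_nat ltn_expl.
have balls r : 0 < r -> (\int[mu]_(t in ball t0 r) (h t)%:E <= (l * (r *+ 2))%:E)%E.
  move=> r0; have : (iavg h (ball t0 r) <= l%:E)%E.
    apply: le_trans hl; apply: ereal_sup_ubound; exists r => //=.
    by rewrite in_itv /= r0.
  rewrite /iavg lebesgue_measure_ball ?(ltW r0) //.
  have r2 : r *+ 2 != 0 by rewrite mulrn_eq0 /= gt_eqF.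
  rewrite inver (negPf r2) => hr.
  have r20 : (0 <= (r *+ 2)%:E :> \bar R)%E by rewrite lee_fin mulrn_wge0 // ltW.
  have := lee_wpmul2l r20 hr; rewrite muleA -EFinM divff // mul1e -EFinM mulrC.
  apply: le_trans; rewrite le_eqVlt; apply/orP; left; apply/eqP.
  by apply: eq_integral => t _; rewrite abse_EFin ger0_norm.
pose B k := ball t0 (2 ^+ k * d).
have r0 k : 0 < 2 ^+ k * d by rewrite mulr_gt0 ?exprn_gt0.
have mB k : measurable (B k) by exact: measurable_ball.
pose I : set R := [set` `[(t0 - pi)%R, (t0 - pi + pi *+ 2)%R]].
have mI : measurable I by exact: measurable_itv.
pose hB k t : \bar R := ((EFin \o h) \_ (B k)) t.
have mhB k : measurable_fun setT (hB k).
  apply/measurable_restrict => //; rewrite ?setTI //; apply: measurable_funTS.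
  exact/measurable_EFinP.
have hB0 k t : (0 <= hB k t)%E.
  by rewrite /hB patchE; case: ifP => // _; rewrite lee_fin.
have mcB k : measurable_fun I (fun t => (c k)%:E * hB k t)%E.
  by apply: measurable_funTS; apply: measurable_funeM.
have cB0 k t : (0 <= (c k)%:E * hB k t)%E by rewrite mule_ge0 ?lee_fin.
apply: (@le_trans _ _ (\int[mu]_(t in I) \sum_(k < K.+1) ((c k)%:E * hB k t))%E).
  apply: ge0_le_integral => //.
  - move=> t tI; rewrite lee_fin mulr_ge0 ?poisson_ge0 // bh //.
    move: tI; rewrite /I /= in_itv /= => /andP[t1 t2].
    by rewrite ler_norml mulr2n in t2 *; apply/andP; split; lra.
  - apply/measurable_EFinP; apply: measurable_funTS.
    apply: continuous_measurable_fun => t; apply: cvgM; first exact: cb.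
    exact: continuous_poisson.
  - by apply: emeasurable_sum => k; exact: (mcB k).
  - move=> t; rewrite /I /= in_itv /= => /andP[t1 t2].
    have tpi : `|t - t0| <= pi.
      by rewrite ler_norml mulr2n in t2 *; apply/andP; split; lra.
    have [k kK [tk Pk]] := poisson_dyadic tpi (le_lt_trans tpi piK).
    rewrite (bigD1 (Ordinal (kK : (k < K.+1)%N))) //= bh //.
    rewrite -[leLHS]adde0; apply: leeD; last exact: sume_ge0.
    rewrite /hB patchE ifT; last by rewrite inE /B /ball /= distrC.
    by rewrite -EFinM lee_fin mulrC ler_wpM2r.
rewrite (ge0_integral_sum mu mI (fun k : 'I_K.+1 => mcB k)) //.
apply: (@le_trans _ _ (\sum_(k < K.+1) (c k * (l * ((2 ^+ k * d) *+ 2)))%:E)%E).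
  apply: lee_sum => k _; rewrite ge0_integralZl_EFin ?c_ge0 //; last first.
    by apply: measurable_funTS; exact: (mhB k).
  rewrite [leRHS]EFinM; apply: lee_wpmul2l; first by rewrite lee_fin c_ge0.
  apply: le_trans (balls _ (r0 k)).
  rewrite [leRHS]integral_mkcond; apply: ge0_subset_integral => //; exact: (mhB k).
rewrite (sumEFin _ _ (fun k : 'I_K.+1 => c k * (l * ((2 ^+ k * d) *+ 2)))) lee_fin.
have -> : \sum_(k < K.+1) c k * (l * ((2 ^+ k * d) *+ 2)) =
    64 * A ^+ 2 * l * \sum_(k < K.+1) 2^-1 ^+ k.
  rewrite mulr_sumr; apply: eq_bigr => k _.
  rewrite /c (_ : 4^-1 = 2^-1 * 2^-1 :> R); last by field.
  have e : 2^-1 ^+ k * 2 ^+ k = 1 :> R by rewrite -exprMn mulVf ?expr1n.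
  rewrite [(_ * _) ^+ k]exprMn -(mulr_natl (2 ^+ k * d) 2).
  transitivity (64 * A ^+ 2 * l * 2^-1 ^+ k * (2^-1 ^+ k * 2 ^+ k)).
    move: (2^-1 ^+ k) (2 ^+ k) => u v.
    field; rewrite gt_eqF //.
  by rewrite e mulr1.
apply: (@le_trans _ _ (64 * A ^+ 2 * l * (1 - 2^-1)^-1)).
  apply: ler_wpM2l; first by rewrite mulr_ge0 // mulr_ge0 // sqr_ge0.
  by apply: geometric_sum_le; lra.
by rewrite le_eqVlt; apply/orP; left; apply/eqP; field.
Qed.

End Kernel.
End MaximalEstimate.

(** * Fatou's theorem in [H^2] *)

Section Fatou.
Context {R : realType}.
Local Notation C := R[i].
Local Notation mu := (@lebesgue_measure R).
Implicit Types (t : R) (z : C) (a : C ^nat).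

Lemma stolzP (alpha : R) (zeta z : C) : stolz_region alpha zeta z <->
  normc z < 1 /\ normc (z - zeta) < alpha * (1 - normc z).
Proof.
rewrite /stolz_region /= normc_lt1 !normcE.
by rewrite (_ : _ * _ = (alpha * (1 - normc z))%:C%C) ?ltcR // rmorphM rmorphB rmorph1.
Qed.

Lemma half_series_le (n m : nat) (c : R) : 0 <= c ->
  \sum_(n <= k < m) c * 2^-1 ^+ k <= 2 * c * 2^-1 ^+ n.
Proof.
move=> c0; have [mn|/ltnW nm] := leqP m n.
  by rewrite big_geq // mulr_ge0 ?exprn_ge0 ?mulr_ge0 // invr_ge0.
rewrite -{1}(add0n n) big_addn.
rewrite (eq_bigr (fun k => c * 2^-1 ^+ n * 2^-1 ^+ k)); last first.
  by move=> k _; rewrite exprD; ring.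
rewrite -mulr_sumr big_mkord (_ : 2 * c * _ = c * 2^-1 ^+ n * (1 - 2^-1)^-1).
  apply: ler_wpM2l; first by rewrite mulr_ge0 // exprn_ge0 // invr_ge0.
  by apply: geometric_sum_le; lra.
by field.
Qed.

Lemma telescope_norm_le (u : C ^nat) (c : R) (n m : nat) : 0 <= c -> (n <= m)%N ->
  (forall k, (n <= k)%N -> normc (u k.+1 - u k) <= c * 2^-1 ^+ k) ->
  normc (u m - u n) <= 2 * c * 2^-1 ^+ n.
Proof.
move=> c0 nm uc; rewrite -(telescope_sumr u nm).
rewrite (le_trans (normc_sum _ _ _)) // (le_trans _ (half_series_le n m c0)) //.
rewrite big_nat [leRHS]big_nat; apply: ler_sum => k /andP[nk _]; exact: uc.
Qed.

Lemma telescope_is_cvg (u : C ^nat) (c : R) (n : nat) : 0 <= c ->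
  (forall k, (n <= k)%N -> normc (u k.+1 - u k) <= c * 2^-1 ^+ k) -> cvgn u.
Proof.
move=> c0 uc; suff /cvg_ex[l ul] : cvgn (fun k => u (k + n)%N).
  by apply/cvg_ex; exists l; rewrite -(cvg_shiftn n).
have : cvgn (series (fun k => u (k + n).+1 - u (k + n)%N)).
  apply: (@normal_series_is_cvg _ _ (2 * c * 2^-1 ^+ n)) => k.
  apply: le_trans (half_series_le n (k + n) c0).
  rewrite (_ : \sum_(n <= i < k + n) _ = \sum_(i < k) c * 2^-1 ^+ (i + n)).
    by apply: ler_sum => i _; apply: uc; exact: leq_addl.
  by rewrite -{1}(add0n n) big_addn addnK big_mkord.
case/cvg_ex => l cl; apply/cvg_ex; exists (u n + l).
rewrite (_ : (fun k => _) =
    (fun k => u n + series (fun k => u (k + n).+1 - u (k + n)%N) k)).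
  by apply: cvgD; [exact: cvg_cst|exact: cl].
apply/funext => k; rewrite /series /=.
rewrite (eq_bigr (fun k => u (k.+1 + n)%N - u (k + n)%N)) //.
by rewrite (telescope_sumr (fun k => u (k + n)%N)) // add0n addrC subrK.
Qed.

Lemma telescope_lim_le (u : C ^nat) l (c : R) (n : nat) : 0 <= c ->
  (forall k, (n <= k)%N -> normc (u k.+1 - u k) <= c * 2^-1 ^+ k) ->
  u @ \oo --> l -> normc (l - u n) <= 2 * c * 2^-1 ^+ n.
Proof.
move=> c0 uc ul.
have cu : (fun k => u k - u n) @ \oo --> l - u n by apply: cvgB; [exact: ul|exact: cvg_cst].
apply: (cvg_normc_le cu); near=> m; apply: telescope_norm_le => //.
by near: m; exact: nbhs_infty_ge.
Unshelve. all: by end_near. Qed.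

Lemma continuous_poly_sum (c : C ^nat) n z : poly_sum c n w @[w --> z] --> poly_sum c n z.
Proof.
have FF : Filter (nbhs z) by exact: nbhs_filter.
rewrite /poly_sum; elim: n => [|n IH].
  rewrite (_ : (fun w => _) = fun=> 0); last by apply/funext => w; rewrite big_ord0.
  rewrite big_ord0.
  exact: (cvg_cst (0 : C)).
rewrite (_ : (fun w => _) = fun w => \sum_(k < n) c k * w ^+ k + c n * w ^+ n); last first.
  by apply/funext => w; rewrite big_ord_recr.
rewrite big_ord_recr /=; apply: cvgD; first exact: IH.
apply: cvgM; first exact: cvg_cst.
elim: n {IH} => [|n IH].
  rewrite (_ : (fun w => _) = fun=> 1); last by apply/funext => w; rewrite expr0.
  by rewrite expr0; exact: cvg_cst.
rewrite (_ : (fun w => _) = fun w => w * w ^+ n); last first.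
  by apply/funext => w; rewrite exprS.
by rewrite exprS; apply: cvgM; [exact: cvg_id|exact: IH].
Qed.

(** The truncation makes the function integrable; the interval is large enough to
   contain the period centered at any [t] in [[0, 2 * pi]]. *)
Definition arc_modulus (c : C ^nat) n : R -> R :=
  (fun t => normc (poly_sum c n (cis t))) \_ [set` `[- pi, pi *+ 3]].

Lemma arc_modulus_measurable c n : measurable_fun setT (arc_modulus c n).
Proof.
apply/measurable_restrict => //; rewrite ?setTI //; apply: measurable_funTS.
by apply: continuous_measurable_fun; apply: continuous_normc; exact: continuous_poly_cis.
Qed.

Lemma arc_modulus_ge0 c n t : 0 <= arc_modulus c n t.
Proof. by rewrite /arc_modulus patchE; case: ifP => // _; exact: normc_ge0. Qed.

Lemma stolz_maximal c n t (l alpha : R) z : 0 <= l -> t \in `[0, 2 * pi] ->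
  (HL_maximal (arc_modulus c n) t <= l%:E)%E ->
  stolz_region alpha (cis t) z ->
  normc (poly_sum c n z) <= 128 * (1 + alpha) ^+ 2 * l.
Proof.
move=> l0 tI hl /stolzP[z1 zS].
have cb : continuous (fun t => normc (poly_sum c n (cis t))).
  by apply: continuous_normc; exact: continuous_poly_cis.
have pi2 : 1 <= pi *+ 2 :> R.
  by rewrite mulr2n; have := pi_ge2 R; lra.
have := maximal_bound z1 zS (@arc_modulus_measurable c n) (@arc_modulus_ge0 c n) l0 cb hl.
move=> /(_ _)/(le_trans (poisson_bound (t - pi) c n z1)).
rewrite lee_fin => h; apply: le_trans (h _).
  by rewrite ler_peMl ?normc_ge0.
move=> s st; rewrite /arc_modulus patchE ifT // inE /= in_itv /=.
move: tI st; rewrite in_itv /= ler_norml => /andP[t1 t2] /andP[s1 s2].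
by rewrite -(mulr_natl pi 3); apply/andP; split; lra.
Qed.

(** The inequality [2 * x <= q^-1 + q * x ^+ 2] with [q = 4 ^+ k] does duty for the
   inequality of Cauchy and Schwarz. *)
Lemma integral_period_le (a0 : R) (c : C ^nat) n (k : nat) :
  \sum_(j < n) normc (c j) ^+ 2 <= 16^-1 ^+ k ->
  (\int[mu]_(t in `[a0, (a0 + pi *+ 2)%R]) (normc (poly_sum c n (cis t)))%:E <=
   (pi *+ 2 * 4^-1 ^+ k)%:E)%E.
Proof.
move=> ck.
have cb : continuous (fun t => normc (poly_sum c n (cis t))).
  by apply: continuous_normc; exact: continuous_poly_cis.
pose q : R := 4 ^+ k / 2; pose e : R := 4^-1 ^+ k / 2.
have q0 : 0 <= q by rewrite divr_ge0 // exprn_ge0.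
have e0 : 0 <= e by rewrite divr_ge0 // exprn_ge0 // invr_ge0.
have v1 : 4^-1 ^+ k * 4 ^+ k = 1 :> R by rewrite -exprMn mulVf ?expr1n.
have mb : measurable_fun (`[a0, (a0 + pi *+ 2)%R] : set R)
    (fun t => (normc (poly_sum c n (cis t)) ^+ 2)%:E).
  apply/measurable_EFinP; apply: measurable_funTS.
  by apply: continuous_measurable_fun; exact: continuous_sqr.
apply: (@le_trans _ _ (\int[mu]_(t in `[a0, (a0 + pi *+ 2)%R])
    (e%:E + q%:E * (normc (poly_sum c n (cis t)) ^+ 2)%:E))%E).
  apply: ge0_le_integral => //.
  - by move=> t _; rewrite lee_fin normc_ge0.
  - apply/measurable_EFinP; apply: measurable_funTS.
    exact: continuous_measurable_fun.
  - by apply: emeasurable_funD => //; apply: measurable_funeM.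
  - move=> t _; rewrite -EFinM -EFinD lee_fin.
    have := sqr_ge0 (4 ^+ k * normc (poly_sum c n (cis t)) - 1).
    move: (normc _) => x; rewrite /q /e.
    have u0 : 0 < 4^-1 ^+ k :> R by rewrite exprn_gt0 // invr_gt0.
    move=> /(mulr_ge0 (ltW u0)).
    have -> : 4^-1 ^+ k * (4 ^+ k * x - 1) ^+ 2 =
      (4^-1 ^+ k * 4 ^+ k) * 4 ^+ k * x ^+ 2 - 2 * (4^-1 ^+ k * 4 ^+ k) * x + 4^-1 ^+ k.
      by ring.
    rewrite v1; move: (4 ^+ k : R) (4^-1 ^+ k : R) => u v; rewrite !expr2; lra.
rewrite ge0_integralD //; last 2 first.
- by move=> t _; rewrite -EFinM lee_fin mulr_ge0 // sqr_ge0.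
- exact: measurable_funeM.
rewrite integral_cst // ge0_integralZl_EFin //; last first.
  by move=> t _; rewrite lee_fin sqr_ge0.
rewrite integral_sqr_poly.
rewrite /= lebesgue_measure_itv /= lte_fin ltrDl mulrn_wgt0 ?pi_gt0 //.
rewrite -EFinB -!EFinM -EFinD lee_fin.
rewrite (_ : a0 + pi *+ 2 - a0 = pi *+ 2); last by rewrite addrAC subrr add0r.
have h : q * (pi *+ 2 * \sum_(j < n) normc (c j) ^+ 2) <=
    q * (pi *+ 2 * 16^-1 ^+ k).
  by rewrite ler_wpM2l // ler_wpM2l // mulrn_wge0 // pi_ge0.
apply: le_trans (lerD (lexx _) h) _; rewrite le_eqVlt; apply/orP; left; apply/eqP.
have -> : 16^-1 ^+ k = 4^-1 ^+ k * 4^-1 ^+ k :> R.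
  by rewrite -exprMn; congr (_ ^+ k); field.
transitivity ((pi : R) *+ 2 * 4^-1 ^+ k * (1 + 4^-1 ^+ k * 4 ^+ k) / 2); last first.
  by rewrite v1; field.
by rewrite /q /e; move: (4 ^+ k : R) (4^-1 ^+ k : R) => u v; field.
Qed.

Lemma integral_arc_modulus (c : C ^nat) n (k : nat) :
  \sum_(j < n) normc (c j) ^+ 2 <= 16^-1 ^+ k ->
  (\int[mu]_t `|(arc_modulus c n t)%:E| <= (pi *+ 4 * 4^-1 ^+ k)%:E)%E.
Proof.
move=> ck.
have cb : continuous (fun t => normc (poly_sum c n (cis t))).
  by apply: continuous_normc; exact: continuous_poly_cis.
pose g t := (normc (poly_sum c n (cis t)))%:E.
have mg : measurable_fun setT g.
  by apply/measurable_EFinP; exact: continuous_measurable_fun.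
have g0 t : (0 <= g t)%E by rewrite lee_fin normc_ge0.
have -> : (\int[mu]_t `|(arc_modulus c n t)%:E| =
    \int[mu]_(t in [set` `[(- pi)%R, (pi *+ 3)%R]]) g t)%E.
  rewrite [RHS]integral_mkcond; apply: eq_integral => t _.
  rewrite abse_EFin ger0_norm ?arc_modulus_ge0 // /arc_modulus !patchE.
  by case: ifP.
have pi0 := pi_gt0 R.
rewrite (@itv_bndbnd_setU _ _ _ (BRight pi)); last 2 first.
- by rewrite bnd_simp; lra.
- by rewrite bnd_simp -(mulr_natl pi 3); lra.
rewrite ge0_integral_setU //; last 2 first.
- exact: measurable_funTS.
- by apply/disj_setPRL => t /=; rewrite !in_itv /= => /andP[t1 _] /andP[_]; rewrite leNgt t1.
rewrite (_ : pi *+ 4 * 4^-1 ^+ k = pi *+ 2 * 4^-1 ^+ k + pi *+ 2 * 4^-1 ^+ k); last first.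
  by rewrite -mulrDl -mulrnDr.
rewrite EFinD; apply: leeD.
  have := integral_period_le (- pi) ck.
  by rewrite (_ : - pi + pi *+ 2 = pi) // mulr2n; ring.
apply: le_trans (integral_period_le pi ck).
rewrite (_ : pi + pi *+ 2 = pi *+ 3) -?mulrS //.
apply: ge0_subset_integral => //; first exact: measurable_funTS.
by move=> t /=; rewrite !in_itv /= => /andP[/ltW -> ->].
Qed.

End Fatou.

Section FatouTheorem.
Context {R : realType}.
Local Notation C := R[i].
Local Notation mu := (@lebesgue_measure R).
Implicit Types (t : R) (z : C) (a : C ^nat).

Lemma l2_tail_small a (e : R) : l2_coef a -> 0 < e ->
  exists N, forall m n, (N <= m)%N -> \sum_(m <= j < n) normc (a j) ^+ 2 <= e.
Proof.
move=> [B aB] e0.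
pose S n := \sum_(k < n) normc (a k) ^+ 2.
have S_nd m n : (m <= n)%N -> S n = S m + \sum_(m <= j < n) normc (a j) ^+ 2.
  move=> mn; rewrite /S -!(big_mkord xpredT (fun j => normc (a j) ^+ 2)).
  by rewrite (@big_cat_nat _ _ _ m).
have t0 m n : 0 <= \sum_(m <= j < n) normc (a j) ^+ 2.
  by apply: sumr_ge0 => j _; exact: sqr_ge0.
have hS : has_sup (range S).
  by split; [exists (S 0%N); exists 0%N|exists B => _ [n _ <-]; exact: aB].
have [_ [N _ <-] SN] := sup_adherent e0 hS.
exists N => m n Nm; have [nm|mn] := leqP n m; first by rewrite big_geq ?(ltW e0).
have Sn : S n <= sup (range S) by apply: sup_ubound; [case: hS|exists n].
have := S_nd _ _ (ltnW mn); have := S_nd _ _ Nm; have := t0 N m; lra.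
Qed.

(** With the rate [16 ^- k], the [k]-th block has norm [4 ^- k] in [L^1], so that the set
   where its maximal function exceeds [2 ^- k] has measure of order [2 ^- k]. *)
Lemma fast_subsequence a : l2_coef a -> exists M : nat -> nat,
  [/\ forall k, (k <= M k)%N, forall k, (M k <= M k.+1)%N &
      forall k n, \sum_(M k <= j < n) normc (a j) ^+ 2 <= 16^-1 ^+ k].
Proof.
move=> la.
have e0 k : 0 < 16^-1 ^+ k :> R by rewrite exprn_gt0 // invr_gt0.
have [N NP] := choice (fun k => l2_tail_small la (e0 k)).
exists (fun k => \sum_(i < k.+1) (N i).+1)%N; split=> [k|k|k n].
- elim: k => [//|k IH]; apply: leq_ltn_trans IH _.
  by rewrite [ltnRHS]big_ord_recr /= addnS ltnS leq_addr.
- by rewrite [leqRHS]big_ord_recr /= leq_addr.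
- by apply: NP; rewrite big_ord_recr /= (leq_trans (leqnSn _)) // leq_addl.
Qed.

Definition block a (m : nat) : C ^nat :=
  fun j => if (m <= j)%N then a j else 0.

Lemma block_sum a m n z : (m <= n)%N ->
  poly_sum (block a m) n z = poly_sum a n z - poly_sum a m z.
Proof.
move=> mn; rewrite /poly_sum -!(big_mkord xpredT (fun j => _ j * z ^+ j)).
rewrite !(@big_cat_nat _ _ _ m 0 n) //= addrAC subrr add0r.
rewrite [X in X + _]big_nat big1 ?add0r => [|j /andP[_ jm]]; last first.
  by rewrite /block leqNgt jm mul0r.
by apply: eq_big_nat => j /andP[mj _]; rewrite /block mj.
Qed.

Lemma block_sqr_sum a m n : (m <= n)%N ->
  \sum_(j < n) normc (block a m j) ^+ 2 = \sum_(m <= j < n) normc (a j) ^+ 2.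
Proof.
move=> mn; rewrite -(big_mkord xpredT (fun j => normc (block a m j) ^+ 2)).
rewrite (@big_cat_nat _ _ _ m 0 n) //= big_nat big1 ?add0r => [|j /andP[_ jm]].
  by apply: eq_big_nat => j /andP[mj _]; rewrite /block mj.
by rewrite /block leqNgt jm normc0 expr0n.
Qed.

Lemma arc_modulus_locally_integrable (c : C ^nat) n :
  locally_integrable setT (arc_modulus c n).
Proof.
split; [exact: arc_modulus_measurable|exact: openT|move=> K _ cK].
have cb : continuous (fun t => normc (poly_sum c n (cis t))).
  by apply: continuous_normc; exact: continuous_poly_cis.
have mK : measurable K by exact: compact_measurable.
have /integrableP[_] := continuous_compact_integrable cK (continuous_subspaceT cb).
apply: le_lt_trans; apply: ge0_le_integral => //.
- apply/measurable_EFinP; apply: measurableT_comp => //; apply: measurable_funTS.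
  exact: arc_modulus_measurable.
- apply/measurable_EFinP; apply: measurableT_comp => //; apply: measurable_funTS.
  exact: continuous_measurable_fun.
- move=> t _; rewrite lee_fin (ger0_norm (arc_modulus_ge0 _ _ _)) /arc_modulus patchE.
  by rewrite (ger0_norm (normc_ge0 _)); case: ifP => // _; exact: normc_ge0.
Qed.

Lemma radial_stolz t (r : R) (alpha : R) : 1 < alpha -> 0 <= r < 1 ->
  stolz_region alpha (cis t) (r%:C%C * cis t).
Proof.
move=> alpha1 /andP[r0 r1]; apply/stolzP.
rewrite normcM normc_cis mulr1 normc_real ger0_norm //; split=> //.
rewrite -{2}(mul1r (cis t)) -mulrBl normcM normc_cis mulr1.
rewrite -(rmorph1 (real_complex R)) -rmorphB normc_real distrC ger0_norm ?subr_ge0 ?(ltW r1) //.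
by rewrite ltr_pMl // subr_gt0.
Qed.

Definition radii (n : nat) : R := 1 - 2^-1 ^+ n.+1.

Lemma radii_itv n : 0 <= radii n < 1.
Proof.
rewrite /radii; apply/andP; split; last first.
  by rewrite ltrBlDr ltrDl exprn_gt0 // invr_gt0.
by rewrite subr_ge0 exprn_ile1 ?invr_ge0 // invf_le1 // ler1n.
Qed.

Lemma radii_cvg t : (radii n)%:C%C * cis t @[n --> \oo] --> cis t.
Proof.
apply/cvg_normcP.
rewrite (_ : (fun n => _) = fun n => 2^-1 ^+ n.+1); last first.
  apply/funext => n; rewrite -{2}(mul1r (cis t)) -mulrBl normcM normc_cis mulr1.
  rewrite -(rmorph1 (real_complex R)) -rmorphB normc_real /radii.
  by rewrite addrAC subrr add0r normrN ger0_norm // exprn_ge0 // invr_ge0.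
have half1 : `|2^-1 : R| < 1 by rewrite ger0_norm ?invr_ge0 // invf_lt1 // ltr1n.
by have := cvg_expr half1; rewrite -cvg_shiftS.
Qed.

(** By continuity along the radius, which lies in the Stolz region of aperture [2]. *)
Lemma boundary_maximal (c : C ^nat) n t (l : R) : 0 <= l -> t \in `[0, 2 * pi] ->
  (HL_maximal (arc_modulus c n) t <= l%:E)%E ->
  normc (poly_sum c n (cis t)) <= 128 * (1 + 2) ^+ 2 * l.
Proof.
move=> l0 tI hl.
have cv : poly_sum c n ((radii k)%:C%C * cis t) @[k --> \oo] --> poly_sum c n (cis t).
  apply: (@cvg_comp _ _ _ (fun k => (radii k)%:C%C * cis t) (poly_sum c n)).
    exact: radii_cvg.
  exact: continuous_poly_sum.
apply: (cvg_normc_le cv); apply: nearW => k.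
by apply: (stolz_maximal l0 tI hl); apply: radial_stolz (radii_itv k); rewrite ltr1n.
Qed.

(** Fatou's theorem in [H^2].  Cut the power series into blocks whose squared norms
   decrease like [16 ^- k].  By the weak-type inequality and the Borel-Cantelli lemma,
   for almost every [t] all but finitely many blocks have a maximal function at
   most [2 ^- k] at [t].  Then the partial sums at the ends of the blocks converge
   uniformly on every Stolz region at [cis t] and at its vertex, and a uniform limit of
   functions continuous at the vertex has a limit there.  The exceptional set is
   the same for all apertures. *)
Theorem l2_nontangential a (f : C -> C) : l2_coef a ->
  (forall z, normc z < 1 -> f z = power_sum a z) ->
  {ae mu, forall t, t \in `[0, 2 * pi] -> exists L : C, forall alpha : R, 1 < alpha ->
    f z @[z --> within (stolz_region alpha (cis t)) (nbhs (cis t))] --> L}.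
Proof.
move=> la fa; have da := l2_coef_summable la.
have [M [kM MS tail]] := fast_subsequence la.
pose F k z := poly_sum a (M k) z.
pose b k := block a (M k).
have FE k z : poly_sum (b k) (M k.+1) z = F k.+1 z - F k z by exact: block_sum.
have b_small k : \sum_(j < M k.+1) normc (b k j) ^+ 2 <= 16^-1 ^+ k.
  by rewrite block_sqr_sum.
pose h k := arc_modulus (b k) (M k.+1).
pose D k : set R := [set t | ((2^-1 ^+ k)%:E < HL_maximal (h k) t)%E].
have lh k : locally_integrable setT (h k) by exact: arc_modulus_locally_integrable.
have p0 k : 0 < 2^-1 ^+ k :> R by rewrite exprn_gt0 // invr_gt0.
have mD k : measurable (D k).
  rewrite -[X in measurable X]setTI; apply: emeasurable_fun_o_infty => //.
  exact: measurable_HL_maximal.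
have muD k : (mu (D k) <= (12 * pi * 2^-1 ^+ k)%:E)%E.
  apply: le_trans (maximal_inequality (lh k) (p0 k)) _.
  apply: (@le_trans _ _ ((3 / 2^-1 ^+ k)%:E * (pi *+ 4 * 4^-1 ^+ k)%:E)%E).
    apply: lee_wpmul2l; first by rewrite lee_fin divr_ge0 // ltW.
    exact: (integral_arc_modulus (b_small k)).
  rewrite -EFinM lee_fin le_eqVlt; apply/orP; left; apply/eqP.
  have -> : 4^-1 ^+ k = 2^-1 ^+ k * 2^-1 ^+ k :> R.
    by rewrite -exprMn; congr (_ ^+ k); field.
  by rewrite -(mulr_natl pi 4); field; rewrite gt_eqF.
have null : mu (lim_sup_set D) = 0.
  apply: lim_sup_set_cvg0 => //.
  apply: (@le_lt_trans _ _ (24 * pi)%:E); last exact: ltry.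
  apply: lime_le; first exact: is_cvg_nneseries.
  apply: nearW => n; apply: (@le_trans _ _ (\sum_(0 <= k < n) (12 * pi * 2^-1 ^+ k)%:E)%E).
    by apply: lee_sum => k _; exact: muD.
  rewrite sumEFin lee_fin (le_trans (half_series_le 0 n _)) //.
    by rewrite mulr_ge0 // pi_ge0.
  by rewrite expr0; lra.
exists (lim_sup_set D); split => //.
  apply: bigcap_measurable; first by exists 0%N.
  move=> n _.
  by apply: bigcup_measurable => k _; exact: mD.
move=> t; apply: contra_notP => tD tI.
have [n0 Dn0] : exists n0, forall k, (n0 <= k)%N -> (HL_maximal (h k) t <= (2^-1 ^+ k)%:E)%E.
  apply: contrapT => nex; apply: tD => n _.
  apply: contrapT => nD; apply: nex; exists n => k nk.
  rewrite leNgt; apply/negP => Dk; apply: nD; exists k => //.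
have stolz_diff alpha z k : stolz_region alpha (cis t) z -> (n0 <= k)%N ->
    normc (F k.+1 z - F k z) <= 128 * (1 + alpha) ^+ 2 * 2^-1 ^+ k.
  by move=> zS nk; rewrite -FE; exact: (stolz_maximal (ltW (p0 k)) tI (Dn0 k nk) zS).
have bd_diff k : (n0 <= k)%N ->
    normc (F k.+1 (cis t) - F k (cis t)) <= 128 * (1 + 2) ^+ 2 * 2^-1 ^+ k.
  by move=> nk; rewrite -FE; exact: (boundary_maximal (ltW (p0 k)) tI (Dn0 k nk)).
have A0 (alpha : R) : 0 <= 128 * (1 + alpha) ^+ 2 by rewrite mulr_ge0 // sqr_ge0.
have /cvg_ex[L FL] := telescope_is_cvg (A0 2) bd_diff.
exists L => alpha alpha1.
have Ff z : normc z < 1 -> F k z @[k --> \oo] --> f z.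
  move=> z1; rewrite (fa z z1).
  have := power_sum_cvg da z1.
  rewrite (_ : series _ = fun n => poly_sum a n z); last first.
    by apply/funext => n; rewrite /series /= big_mkord.
  move=> c; apply: (@cvg_comp _ _ _ M (fun n => poly_sum a n z) _ _ _ _ c).
  apply/cvgnyPge => N; near=> k; apply: leq_trans (kM k).
  by near: k; exact: nbhs_infty_ge.
(* Both [f z - F k z] and [L - F k (cis t)] are small, uniformly in [z], for large [k]. *)
apply/cvgrPdist_lt => e0 e0_gt0.
have /complex_realP[e ee] : e0 \is Num.real by rewrite gtr0_real.
subst e0; have e_gt0 : 0 < e by rewrite -ltcR.
pose B := 128 * (1 + alpha) ^+ 2 + 128 * (1 + 2) ^+ 2 : R.
have B0 : 0 <= B by rewrite addr_ge0.
have [k nk Bk] : exists2 k, (n0 <= k)%N & 2 * B * 2^-1 ^+ k < e / 2.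
  have c0 : 2 * B * 2^-1 ^+ k @[k --> \oo] --> 0.
    rewrite -(mulr0 (2 * B)); apply: cvgM; first exact: cvg_cst.
    by apply: cvg_expr; rewrite ger0_norm ?invr_ge0 // invf_lt1 // ltr1n.
  near \oo => k; exists k; first by near: k; exact: nbhs_infty_ge.
  near: k; apply: (cvgr_lt _ c0); first by rewrite divr_gt0.
have /cvg_normcP/cvgrPdist_lt/(_ (e / 2) _) := @continuous_poly_sum R a (M k) (cis t).
rewrite divr_gt0 // => /(_ isT) near_k.
rewrite near_withinE; near=> z => zS.
rewrite normc_lt.
have [z1 _] := (stolzP _ _ _).1 zS.
have h1 := telescope_lim_le (A0 alpha) (fun k => @stolz_diff alpha z k zS) (Ff z z1).
have h1k := telescope_lim_le (A0 alpha)
  (fun j kj => stolz_diff alpha z j zS (leq_trans nk kj)) (Ff z z1).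
have h2k := telescope_lim_le (A0 2) (fun j kj => bd_diff j (leq_trans nk kj)) FL.
have h3 : normc (F k z - F k (cis t)) < e / 2.
  rewrite -[ltLHS]ger0_norm ?normc_ge0 // -normrN -sub0r.
  by near: z.
have -> : L - f z = (L - F k (cis t)) + (F k (cis t) - F k z) + (F k z - f z) by ring.
apply: le_lt_trans (le_normcD _ _) _.
apply: le_lt_trans (lerD (le_normcD _ _) (lexx _)) _.
rewrite normcB in h1k; rewrite (normcB (F k (cis t))).
have : 2 * B * 2^-1 ^+ k = 2 * (128 * (1 + alpha) ^+ 2) * 2^-1 ^+ k +
   2 * (128 * (1 + 2) ^+ 2) * 2^-1 ^+ k by rewrite /B; ring.
move: h1k h2k h3 Bk; lra.
Unshelve. all: by end_near. Qed.

End FatouTheorem.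

(** * The space [ell^2] and the backward shift *)

Section SquareSummableSequences.
Context {R : realType}.
Local Notation C := R[i].

Section Dot.
Context {n : nat}.
Implicit Types (v w : 'cV[C]_n) (c : C).

Lemma cdotDl v1 v2 w : cdot (v1 + v2) w = cdot v1 w + cdot v2 w.
Proof. by rewrite -big_split; apply: eq_bigr => i _; rewrite mxE mulrDl. Qed.

Lemma cdotZl c v w : cdot (c *: v) w = c * cdot v w.
Proof. by rewrite mulr_sumr; apply: eq_bigr => i _; rewrite mxE mulrA. Qed.

Lemma cdotC v w : cdot w v = (cdot v w)^*.
Proof.
by rewrite rmorph_sum; apply: eq_bigr => i _; rewrite rmorphM /= conjCK mulrC.
Qed.

Lemma cdot0l w : cdot 0 w = 0.
Proof. by rewrite -(scale0r (0 : 'cV_n)) cdotZl mul0r. Qed.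

Lemma cdot_delta v i : cdot v (delta_mx i ord0) = v i ord0.
Proof.
rewrite /cdot (bigD1 i) //= mxE !eqxx conjC1 mulr1 big1 ?addr0 // => j ji.
by rewrite mxE (negPf ji) conjC0 mulr0.
Qed.

(** Means of [normc (v i ord0) ^+ 2 / e] and [e * normc (w i ord0) ^+ 2]; the weight [e] is
   there to be adapted to the norm of an operator in [l2_coef_functional]. *)
Lemma normc_cdot v w (e : R) : 0 < e ->
  normc (cdot v w) <= (sqnorm v / e + e * sqnorm w) / 2.
Proof.
move=> e0; rewrite (le_trans (normc_sum _ _ _)) // /sqnorm mulr_suml mulr_sumr.
rewrite -big_split mulr_suml; apply: ler_sum => i _ /=.
rewrite normcM normc_conj; set x := normc _; set y := normc _.
rewrite ler_pdivlMr // -subr_ge0.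
rewrite (_ : _ - _ = (x - e * y) ^+ 2 / e); last by field; rewrite gt_eqF.
by rewrite divr_ge0 ?sqr_ge0 // ltW.
Qed.

Lemma le_sqnorm v i : normc (v i ord0) ^+ 2 <= sqnorm v.
Proof.
by rewrite /sqnorm (bigD1 i) //= lerDl sumr_ge0 // => j _; exact: sqr_ge0.
Qed.

End Dot.

Section L2.
Context {n : nat}.
Implicit Types (x y : ell2 R n) (v w : 'cV[C]_n) (c : C).

Lemma square_summableP (x : nat -> 'cV[C]_n) :
  (x \in square_summable) <-> exists B : R, forall N, \sum_(k < N) sqnorm (x k) <= B.
Proof.
have ge0 k : (0 <= (sqnorm (x k))%:E)%E by rewrite lee_fin sqnorm_ge0.
have part N : (\sum_(0 <= k < N) (sqnorm (x k))%:E)%E = (\sum_(k < N) sqnorm (x k))%:E.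
  by rewrite sumEFin big_mkord.
split; rewrite unfold_in.
- move=> xoo; exists (fine (\sum_(0 <= k <oo) (sqnorm (x k))%:E)%E) => N.
  rewrite -lee_fin fineK; last first.
    by rewrite ge0_fin_numE // nneseries_ge0.
  by rewrite -part; apply: nneseries_lim_ge => k _ _.
- move=> [B xB]; apply: (@le_lt_trans _ _ B%:E); last exact: ltry.
  apply: lime_le; first by apply: is_cvg_nneseries => k _ _.
  by apply: nearW => N; rewrite part lee_fin.
Qed.

Lemma l2norm_sqr x : l2norm x ^+ 2 = fine (\sum_(0 <= k <oo) (sqnorm (x k))%:E)%E.
Proof.
rewrite sqr_sqrtr // fine_ge0 // nneseries_ge0 // => k _ _.
by rewrite lee_fin sqnorm_ge0.
Qed.

Lemma l2norm_ge_sum x N : \sum_(k < N) sqnorm (x k) <= l2norm x ^+ 2.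
Proof.
have ge0 k : (0 <= (sqnorm (x k))%:E)%E by rewrite lee_fin sqnorm_ge0.
rewrite l2norm_sqr -lee_fin fineK; last first.
  by rewrite ge0_fin_numE ?nneseries_ge0 //; have := ell2P x; rewrite unfold_in.
rewrite (_ : (_ %:E)%E = (\sum_(0 <= k < N) (sqnorm (x k))%:E)%E).
  by apply: nneseries_lim_ge => k _ _.
by rewrite sumEFin big_mkord.
Qed.

Lemma l2norm_le_sum x B : (forall N, \sum_(k < N) sqnorm (x k) <= B) ->
  l2norm x ^+ 2 <= B.
Proof.
move=> xB; have ge0 k : (0 <= (sqnorm (x k))%:E)%E by rewrite lee_fin sqnorm_ge0.
rewrite l2norm_sqr -lee_fin fineK; last first.
  by rewrite ge0_fin_numE ?nneseries_ge0 //; have := ell2P x; rewrite unfold_in.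
apply: lime_le; first by apply: is_cvg_nneseries => k _ _.
by apply: nearW => N; rewrite sumEFin big_mkord lee_fin.
Qed.

Lemma ell2_eq x y : (forall k, x k = y k) -> x = y.
Proof. by move=> xy; apply: val_inj; apply/funext => k; exact: xy. Qed.

Lemma ell2D x y k : (x + y) k = x k + y k. Proof. by []. Qed.
Lemma ell2Z c x k : (c *: x) k = c *: x k. Proof. by []. Qed.
Lemma ell2B x y k : (x - y) k = x k - y k. Proof. by []. Qed.

Lemma l2dot_partial x y (e : R) N : 0 < e ->
  \sum_(k < N) normc (cdot (x k) (y k)) <=
  (l2norm x ^+ 2 / e + e * l2norm y ^+ 2) / 2.
Proof.
move=> e0; apply: (@le_trans _ _ (((\sum_(k < N) sqnorm (x k)) / e +
    e * \sum_(k < N) sqnorm (y k)) / 2)).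
  rewrite mulr_suml mulr_sumr -big_split mulr_suml; apply: ler_sum => k _.
  exact: normc_cdot.
rewrite ler_pM2r ?invr_gt0 // lerD //.
  by rewrite ler_pM2r ?invr_gt0 // l2norm_ge_sum.
by rewrite ler_pM2l // l2norm_ge_sum.
Qed.

Lemma l2dot_cvg x y : series (fun k => cdot (x k) (y k)) @ \oo --> l2dot x y.
Proof.
exact: (normal_series_is_cvg (fun N => l2dot_partial x y N ltr01)).
Qed.

Lemma normc_l2dot x y (e : R) : 0 < e ->
  normc (l2dot x y) <= (l2norm x ^+ 2 / e + e * l2norm y ^+ 2) / 2.
Proof.
move=> e0; apply: (cvg_normc_le (l2dot_cvg (x := x) (y := y))); apply: nearW => N.
rewrite (le_trans _ (l2dot_partial x y N e0)) // /series /= big_mkord.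
exact: normc_sum.
Qed.

Lemma l2dotDl x1 x2 y : l2dot (x1 + x2) y = l2dot x1 y + l2dot x2 y.
Proof.
apply: cvg_lim => //.
rewrite (_ : series _ = fun N => series (fun k => cdot (x1 k) (y k)) N +
    series (fun k => cdot (x2 k) (y k)) N).
  by apply: cvgD; exact: l2dot_cvg.
by apply/funext => N; rewrite /series /= -big_split; apply: eq_bigr => k _; exact: cdotDl.
Qed.

Lemma l2dotZl c x y : l2dot (c *: x) y = c * l2dot x y.
Proof.
apply: cvg_lim => //.
rewrite (_ : series _ = fun N => c * series (fun k => cdot (x k) (y k)) N).
  by apply: cvgM; [exact: cvg_cst|exact: l2dot_cvg].
apply/funext => N; rewrite /series /= mulr_sumr; apply: eq_bigr => k _; exact: cdotZl.
Qed.

Lemma l2dot0l y : l2dot 0 y = 0.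
Proof. by rewrite -(scale0r (0 : ell2 R n)) l2dotZl mul0r. Qed.

Lemma l2dot_suml N (F : nat -> ell2 R n) y :
  l2dot (\sum_(k < N) F k) y = \sum_(k < N) l2dot (F k) y.
Proof. exact: (big_morph (fun x => l2dot x y) (fun a b => l2dotDl a b y) (l2dot0l y)). Qed.

Lemma l2dotC x y : l2dot y x = (l2dot x y)^*.
Proof.
apply: cvg_lim => //; apply/cvg_normcP.
rewrite (_ : (fun N => _) = fun N => normc (series (fun k => cdot (x k) (y k)) N - l2dot x y)).
  by apply/cvg_normcP; exact: l2dot_cvg.
apply/funext => N; rewrite -[RHS]normc_conj rmorphB /= /series /= rmorph_sum /=.
by congr (normc (_ - _)); apply: eq_bigr => k _; exact: cdotC.
Qed.

Lemma l2dot_single (j : nat) v y : l2dot (l2single j v) y = cdot v (y j).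
Proof.
apply: cvg_lim => //; rewrite -(cvg_shiftn j.+1).
rewrite (_ : (fun N => _) = fun=> cdot v (y j)); first exact: cvg_cst.
apply/funext => N; rewrite /series /= big_mkord.
have jN : (j < N + j.+1)%N by rewrite addnS ltnS leq_addl.
rewrite (bigD1 (Ordinal jN)) //= eqxx big1 ?addr0 // => k kj.
by rewrite ifN ?cdot0l //; apply: contraNN kj => /eqP kj; apply/eqP/val_inj.
Qed.

Lemma l2dot_inj x y : (forall z, l2dot z x = l2dot z y) -> x = y.
Proof.
move=> h; apply: ell2_eq => k; apply/colP => i.
have := h (l2single k (delta_mx i ord0)); rewrite !l2dot_single.
by rewrite cdotC [RHS]cdotC !cdot_delta => /(inv_inj (@conjCK _)).
Qed.

Lemma l2dot_injl x y : (forall z, l2dot x z = l2dot y z) -> x = y.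
Proof. by move=> h; apply: l2dot_inj => z; rewrite l2dotC h -l2dotC. Qed.

Lemma bshift_square_summable x : (fun k => x k.+1) \in square_summable.
Proof.
apply/square_summableP; exists (l2norm x ^+ 2) => N.
apply: le_trans (l2norm_ge_sum x N.+1); rewrite big_ord_recl /=.
by rewrite lerDr sqnorm_ge0.
Qed.

Definition bshift x : ell2 R n := Ell2 (bshift_square_summable x).

Lemma iter_bshiftE x N k : iter N bshift x k = x (k + N)%N.
Proof.
elim: N k => [|N IH] k; first by rewrite addn0.
by rewrite iterS [LHS]IH addnS.
Qed.

Lemma bshift_linear c x y : bshift (c *: x + y) = c *: bshift x + bshift y.
Proof. exact: ell2_eq. Qed.

Lemma l2norm_iter_bshift x N : l2norm (iter N bshift x) ^+ 2 <= l2norm x ^+ 2.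
Proof.
apply: l2norm_le_sum => K; apply: le_trans (l2norm_ge_sum x (N + K)).
rewrite big_split_ord /= ler_wpDl ?sumr_ge0 // => [i _|]; first exact: sqnorm_ge0.
by apply: ler_sum => i _; rewrite iter_bshiftE addnC.
Qed.

Lemma shiftK x : bshift (Defs.shift x) = x.
Proof. exact: ell2_eq. Qed.

Lemma embed_shift x : l2embed (x 0%N) + Defs.shift (bshift x) = x.
Proof.
by apply: ell2_eq => -[|k]; rewrite ell2D /= ?addr0 ?add0r.
Qed.

Lemma l2dot_shift x y : l2dot (Defs.shift x) y = l2dot x (bshift y).
Proof.
apply: cvg_lim => //; rewrite -cvg_shiftS.
rewrite (_ : (fun N => _) = series (fun k => cdot (x k) (bshift y k))).
  exact: l2dot_cvg.
by apply/funext => N; rewrite /series /= big_nat_recl //= cdot0l add0r.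
Qed.

End L2.

Lemma linear_0 (U V : lmodType C) (T : U -> V) : linear T -> T 0 = 0.
Proof. by move=> lT; have := lT (-1) 0 0; rewrite scaler0 add0r scaleN1r addNr. Qed.

Lemma linear_D (U V : lmodType C) (T : U -> V) : linear T -> {morph T : x y / x + y}.
Proof. by move=> lT x y; have := lT 1 x y; rewrite !scale1r. Qed.

Lemma linear_Z (U V : lmodType C) (T : U -> V) : linear T ->
  forall c, {morph T : x / c *: x}.
Proof. by move=> lT c x; have := lT c x 0; rewrite (linear_0 lT) !addr0. Qed.

(** An adjoint is unique as soon as the form on [U] separates the points. *)
Lemma adjointE (U V : lmodType C) (dU : U -> U -> C) (dV : V -> V -> C)
    (T : U -> V) (T' : V -> U) :
  (forall a b, (forall u, dU u a = dU u b) -> a = b) ->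
  (forall u v, dV (T u) v = dU u (T' v)) -> adjoint dU dV T = T'.
Proof.
move=> inj TT'; apply/funext => v; apply: inj => u.
rewrite -TT' /adjoint; case: xgetP => [T'' _ <- //|/(_ T') []]; exact: TT'.
Qed.

Lemma adjoint_shift n : adjoint (@l2dot R n) (@l2dot R n) (@Defs.shift R n) = bshift.
Proof. by apply: adjointE; [exact: l2dot_inj|exact: l2dot_shift]. Qed.

Lemma cdot_inj n (v w : 'cV[C]_n) : (forall u, cdot u v = cdot u w) -> v = w.
Proof.
move=> h; apply/colP => i; have := h (delta_mx i ord0).
by rewrite cdotC [RHS]cdotC !cdot_delta => /(inv_inj (@conjCK _)).
Qed.

Lemma adjoint_embed n :
  adjoint (@cdot R n) (@l2dot R n) (@l2embed R n) = fun x => x 0%N.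
Proof.
by apply: adjointE; [exact: cdot_inj|move=> u v; exact: l2dot_single].
Qed.

Lemma inverseP (U : lmodType C) (T T' : U -> U) : cancel T T' -> cancel T' T ->
  cancel T (inverse T) /\ cancel (inverse T) T.
Proof.
move=> TT' T'T; rewrite /inverse; case: xgetP => [T'' _ //|nT].
by case: (nT T').
Qed.

Lemma cancel_linear (U V : lmodType C) (T : U -> V) (T' : V -> U) :
  cancel T T' -> cancel T' T -> linear T -> linear T'.
Proof. by move=> TT' T'T lT c x y; rewrite -{1}(T'T x) -{1}(T'T y) -lT TT'. Qed.

End SquareSummableSequences.

(** * The resolvent of the backward shift *)

Section Resolvent.
Context {R : realType}.
Local Notation C := R[i].

Definition pcons (c : C) (a : C ^nat) : C ^nat :=
  fun k => if k is k'.+1 then a k' else c.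

Lemma power_sum_pcons c (a : C ^nat) z : disc_summable a -> normc z < 1 ->
  power_sum (pcons c a) z = c + z * power_sum a z.
Proof.
move=> da z1; apply: cvg_lim => //; rewrite -cvg_shiftS.
rewrite (_ : (fun N => _) = fun N => c + z * series (fun k => a k * z ^+ k) N).
  apply: cvgD; first exact: cvg_cst.
  by apply: cvgM; [exact: cvg_cst|exact: power_sum_cvg].
apply/funext => N; rewrite /series /= big_nat_recl //= expr0 mulr1; congr (_ + _).
by rewrite mulr_sumr; apply: eq_bigr => k _; rewrite exprS mulrCA.
Qed.

Lemma l2_coef_pcons c (a : C ^nat) : l2_coef a -> l2_coef (pcons c a).
Proof.
move=> [B aB]; exists (normc c ^+ 2 + B) => -[|n].
  by rewrite big_ord0 addr_ge0 ?sqr_ge0 //; have := aB 0%N; rewrite big_ord0.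
rewrite big_ord_recl /= lerD2l; exact: aB.
Qed.

Lemma l2_coefZ (c : C) (a : C ^nat) : l2_coef a -> l2_coef (fun k => c * a k).
Proof.
move=> [B aB]; exists (normc c ^+ 2 * B) => n.
rewrite (eq_bigr (fun k : 'I_n => normc c ^+ 2 * normc (a k) ^+ 2)); last first.
  by move=> k _; rewrite normcM exprMn.
by rewrite -mulr_sumr; apply: ler_wpM2l; [exact: sqr_ge0|exact: aB].
Qed.

Lemma power_sumZ (c : C) (a : C ^nat) z : disc_summable a -> normc z < 1 ->
  power_sum (fun k => c * a k) z = c * power_sum a z.
Proof.
move=> da z1; apply: cvg_lim => //.
rewrite (_ : series _ = fun N => c * series (fun k => a k * z ^+ k) N).
  by apply: cvgM; [exact: cvg_cst|exact: power_sum_cvg].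
by apply/funext => N; rewrite /series /= mulr_sumr; apply: eq_bigr => k _; rewrite mulrA.
Qed.

Lemma normc_power_sum (a : C ^nat) z (c : R) : (forall k, normc (a k) <= c) ->
  normc z < 1 -> normc (power_sum a z) <= c / (1 - normc z).
Proof.
move=> ac z1; have c0 : 0 <= c := le_trans (normc_ge0 _) (ac 0%N).
apply: (cvg_normc_le (power_sum_cvg (bounded_coef_summable ac) z1)).
apply: nearW => N; rewrite /series /= big_mkord (le_trans (normc_sum _ _ _)) //.
apply: le_trans (ler_wpM2l c0 (geometric_sum_le N (normc_ge0 z) z1)).
rewrite mulr_sumr; apply: ler_sum => k _.
by rewrite normcM normcX ler_wpM2r ?exprn_ge0 ?normc_ge0.
Qed.

Section Shift.
Context {n : nat}.
Implicit Types (x y u q : ell2 R n) (z : C).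

Lemma ell2_coef_le x k i : normc (x k i ord0) <= 1 + l2norm x ^+ 2.
Proof.
have h1 : normc (x k i ord0) ^+ 2 <= l2norm x ^+ 2.
  apply: le_trans (le_sqnorm _ _) _.
  apply: le_trans (l2norm_ge_sum x k.+1); rewrite big_ord_recr /= lerDr.
  by apply: sumr_ge0 => j _; exact: sqnorm_ge0.
have := normc_ge0 (x k i ord0); nra.
Qed.

(** Convexity of the square, with the weights [1 - normc z] and [normc z]. *)
Lemma sqnorm_contraction (v w : 'cV[C]_n) z : normc z < 1 ->
  sqnorm (v + z *: w) <= sqnorm v / (1 - normc z) + normc z * sqnorm w.
Proof.
move=> z1; have d0 : 0 < 1 - normc z by rewrite subr_gt0.
rewrite /sqnorm mulr_suml mulr_sumr -big_split; apply: ler_sum => i _ /=.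
rewrite !mxE; have r0 := normc_ge0 z.
have := le_normcD (v i ord0) (z * w i ord0); rewrite normcM.
have := normc_ge0 (v i ord0 + z * w i ord0).
move: (normc (v i ord0 + _)) (normc (v i ord0)) (normc (w i ord0)) => s p' q' s0 sle.
apply: (@le_trans _ _ ((p' + normc z * q') ^+ 2)).
  by rewrite lerXn2r // nnegrE ?(le_trans s0).
rewrite -subr_ge0.
rewrite (_ : _ - _ = normc z * (p' - (1 - normc z) * q') ^+ 2 / (1 - normc z)).
  by apply: divr_ge0; [apply: mulr_ge0; [exact: r0|exact: sqr_ge0]|exact: ltW].
by field; rewrite gt_eqF.
Qed.

(** The Neumann series converges coordinatewise to a bounded sequence [y] with
   [y k = x k + z *: y k.+1].  By [sqnorm_contraction], a partial sum [S] of the squared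
   norms of [y] satisfies [S <= X + normc z * (S + K)] for constants [X] and [K],
   hence is bounded. *)
Lemma resolvent_exists z x : normc z < 1 -> exists y, y - z *: bshift y = x.
Proof.
move=> z1; have d0 : 0 < 1 - normc z by rewrite subr_gt0.
pose c := 1 + l2norm x ^+ 2; have xc k i : normc (x k i ord0) <= c by exact: ell2_coef_le.
pose y (k : nat) : 'cV[C]_n := \col_i power_sum (fun j => x (k + j)%N i ord0) z.
have yE k : y k = x k + z *: y k.+1.
  apply/colP => i; rewrite !mxE.
  have dx : disc_summable (fun j => x (k.+1 + j)%N i ord0).
    by apply: (@bounded_coef_summable _ _ c) => j.
  rewrite -(power_sum_pcons _ dx z1); congr power_sum; apply/funext => -[|j] /=.
    by rewrite addn0.
  by rewrite addSnnS.
have yb k : sqnorm (y k) <= \sum_(i < n) (c / (1 - normc z)) ^+ 2.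
  apply: ler_sum => i _; rewrite !mxE lerXn2r ?nnegrE ?normc_ge0 //.
    by rewrite divr_ge0 ?(ltW d0) // addr_ge0 // sqr_ge0.
  by apply: normc_power_sum => // j.
set K := \sum_(i < n) _ in yb.
have y2 : y \in square_summable.
  apply/square_summableP.
  exists ((l2norm x ^+ 2 / (1 - normc z) + normc z * K) / (1 - normc z)) => N.
  rewrite ler_pdivlMr //.
  have : \sum_(k < N) sqnorm (y k) <= \sum_(k < N) (sqnorm (x k) / (1 - normc z)
      + normc z * sqnorm (y k.+1)).
    by apply: ler_sum => k _; rewrite {1}yE sqnorm_contraction.
  rewrite big_split /= -mulr_suml -mulr_sumr.
  have tel : \sum_(k < N) sqnorm (y k.+1) <= \sum_(k < N) sqnorm (y k) + K.
    have : \sum_(k < N.+1) sqnorm (y k) <= \sum_(k < N) sqnorm (y k) + K.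
      by rewrite big_ord_recr lerD2l.
    rewrite big_ord_recl /=; apply: le_trans.
    by rewrite lerDr sqnorm_ge0.
  have xs : (\sum_(k < N) sqnorm (x k)) / (1 - normc z) <= l2norm x ^+ 2 / (1 - normc z).
    by rewrite ler_pM2r ?invr_gt0 // l2norm_ge_sum.
  have := ler_wpM2l (normc_ge0 z) tel.
  rewrite mulrDr mulrBr mulr1; move: xs.
  rewrite [X in _ -> _ -> _ -> X - _ <= _](_ : _ = \sum_(k < N) sqnorm (y k)) //.
  rewrite [normc z * \sum_(k < N) sqnorm (y k)]mulrC.
  lra.
exists (Ell2 y2); apply: ell2_eq => k; rewrite ell2B ell2Z /=.
by rewrite {1}yE addrK.
Qed.

Lemma resolvent_iter z x u N : u - z *: bshift u = x ->
  u = \sum_(k < N) z ^+ k *: iter k bshift x + z ^+ N *: iter N bshift u.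
Proof.
move=> ux; elim: N => [|N IH]; first by rewrite big_ord0 expr0 scale1r add0r.
rewrite big_ord_recr /= -addrA {1}IH; congr (_ + _).
rewrite exprSr -scalerA -scalerDr; congr (_ *: _).
apply: ell2_eq => k; rewrite ell2D ell2Z /= !iter_bshiftE.
by rewrite -ux ell2B ell2Z /= addSn subrK.
Qed.

Lemma resolvent_inj z u : normc z < 1 -> u - z *: bshift u = 0 -> u = 0.
Proof.
move=> z1 u0; apply: ell2_eq => k; apply/colP => i.
suff : normc (u k i ord0) <= 0.
  move=> h; rewrite [RHS]mxE; apply: eq0_normc; apply/eqP.
  by rewrite eq_le h normc_ge0.
have c0 : normc z ^+ N * (1 + l2norm u ^+ 2) @[N --> \oo] --> 0.
  rewrite -(mul0r (1 + l2norm u ^+ 2)); apply: cvgM; last exact: cvg_cst.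
  by apply: cvg_expr; rewrite ger0_norm ?normc_ge0.
apply: (cvgr_to_ge c0); apply: nearW => N.
have it0 j : iter j bshift (0 : ell2 R n) = 0.
  by apply: ell2_eq => l; rewrite iter_bshiftE.
rewrite [X in normc (ell2_seq X k i ord0)](resolvent_iter N u0).
rewrite big1 ?add0r; last by move=> j _; rewrite it0 scaler0.
rewrite ell2Z mxE normcM normcX ler_wpM2l ?exprn_ge0 ?normc_ge0 //.
by rewrite iter_bshiftE ell2_coef_le.
Qed.

Lemma inverse_resolvent z : normc z < 1 ->
  let A x := x - z *: bshift x in
  cancel A (inverse A) /\ cancel (inverse A) A.
Proof.
move=> z1 A; have [T AT] := choice (fun x => resolvent_exists x z1).
have TA : cancel A T.
  move=> x; apply/eqP; rewrite -subr_eq0; apply/eqP; apply: (resolvent_inj z1).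
  have := AT (A x); move: (T (A x)) => y Ay.
  have -> : bshift (y - x) = bshift y - bshift x by exact: ell2_eq.
  rewrite scalerBr opprB [z *: bshift x - _]addrC addrACA.
  by rewrite [- x + _]addrC -[z *: bshift x - x]opprB Ay subrr.
by apply: (inverseP TA).
Qed.

(** The remainder of the Neumann series tends to [0] because the iterates of the
   backward shift are contractions. *)
Lemma resolvent_dot z x u q : normc z < 1 -> u - z *: bshift u = x ->
  l2dot u q = power_sum (fun k => l2dot (iter k bshift x) q) z.
Proof.
move=> z1 ux; apply/esym/cvg_lim => //.
pose B := (l2norm u ^+ 2 / 1 + 1 * l2norm q ^+ 2) / 2.
have c0 : normc z ^+ N * B @[N --> \oo] --> 0.
  rewrite -(mul0r B); apply: cvgM; last exact: cvg_cst.
  by apply: cvg_expr; rewrite ger0_norm ?normc_ge0.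
apply/cvg_normcP; apply: (squeeze_cvgr _ (cvg_cst 0) c0).
apply: nearW => N; rewrite normc_ge0 /=.
rewrite {1}(resolvent_iter N ux) l2dotDl l2dotZl.
rewrite (l2dot_suml N (fun k => z ^+ k *: iter k bshift x)) /series /= big_mkord.
rewrite opprD addrA.
rewrite [X in X - _ - _](eq_bigr (fun k : 'I_N => l2dot (z ^+ k *: iter k bshift x) q));
  last by move=> k _; rewrite l2dotZl mulrC.
rewrite subrr add0r normcN normcM normcX.
rewrite ler_wpM2l ?exprn_ge0 ?normc_ge0 // (le_trans (normc_l2dot _ _ ltr01)) //.
by rewrite ler_pM2r ?invr_gt0 // lerD2r !divr1 l2norm_iter_bshift.
Qed.

Lemma l2_coef_entry x i : l2_coef (fun k => x k i ord0).
Proof.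
exists (l2norm x ^+ 2) => N; apply: le_trans (l2norm_ge_sum x N).
by apply: ler_sum => k _; exact: le_sqnorm.
Qed.

End Shift.

(** The functional [x |-> l2dot (H x) q] is bounded; evaluate it at the sequence of the
   conjugates of the first [N] coefficients [b].  The value is the sum [s] of the squares
   of their moduli, whereas [x] only has a norm of order [sqrt s]. *)
Lemma l2_coef_functional p m (H : ell2 R p -> ell2 R m) (v : 'cV[C]_p) (q : ell2 R m) :
  bounded_operator H -> l2_coef (fun k => l2dot (H (l2single k v)) q).
Proof.
move=> [linH [M0 HM]]; pose b k := l2dot (H (l2single k v)) q.
(* [M] bounds [l2norm (H x) ^+ 2 / s]; with [e > M] that term is absorbed by [s] below. *)
pose M := M0 ^+ 2 * sqnorm v; pose e := M + 1.
have M_ge0 : 0 <= M by rewrite mulr_ge0 ?sqr_ge0 ?sqnorm_ge0.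
have e0 : 0 < e by rewrite ltr_wpDl.
exists (e * l2norm q ^+ 2) => N.
set s := \sum_(k < N) _.
have s0 : 0 <= s by apply: sumr_ge0 => k _; exact: sqr_ge0.
pose x : ell2 R p := \sum_(k < N) (b k)^* *: l2single k v.
have xE k : x k = if (k < N)%N then (b k)^* *: v else 0.
  rewrite /x; elim: N {s s0 x} => [|N IH]; first by rewrite big_ord0.
  rewrite big_ord_recr ell2D IH ell2Z /= ltnS [(k <= N)%N]leq_eqVlt.
  case: (eqVneq k N) => [->|kN]; first by rewrite ltnn /= add0r.
  by rewrite /= scaler0 addr0.
have xs : l2norm x ^+ 2 <= s * sqnorm v.
  apply: l2norm_le_sum => K; rewrite /s mulr_suml.
  have E k : sqnorm (x k) = if (k < N)%N then normc (b k) ^+ 2 * sqnorm v else 0.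
    by rewrite xE; case: ifP => _; rewrite ?sqnorm0 // sqnormZ normc_conj.
  rewrite (eq_bigr _ (fun (k : 'I_K) _ => E k)) -big_mkcond /=.
  rewrite -(big_mkord (fun k => (k < N)%N) (fun k => normc (b k) ^+ 2 * sqnorm v)).
  rewrite -(big_mkord xpredT (fun k => normc (b k) ^+ 2 * sqnorm v)).
  have t0 k : 0 <= normc (b k) ^+ 2 * sqnorm v by rewrite mulr_ge0 ?sqr_ge0 ?sqnorm_ge0.
  rewrite big_mkcond /=.
  have [KN|/ltnW NK] := leqP K N.
    rewrite (@big_cat_nat _ _ _ K 0 N) //= ler_wpDr ?sumr_ge0 //.
    by apply: ler_sum => k _; case: ifP.
  rewrite (@big_cat_nat _ _ _ N 0 K) //= [X in _ + X]big_nat.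
  rewrite [X in _ + X]big1 ?addr0; last by move=> k /andP[Nk _]; rewrite ltnNge Nk.
  by apply: ler_sum => k _; case: ifP.
have sE : l2dot (H x) q = s%:C%C.
  rewrite /x (big_morph H (linear_D linH) (linear_0 linH)).
  rewrite (l2dot_suml N (fun k => H ((b k)^* *: l2single k v))) /s rmorph_sum /=.
  apply: eq_bigr => k _; rewrite (linear_Z linH) l2dotZl -/(b k) mulrC normcJ.
  by rewrite rmorphXn.
have Hx : l2norm (H x) ^+ 2 <= M * s.
  apply: (@le_trans _ _ (M0 ^+ 2 * l2norm x ^+ 2)).
    rewrite -exprMn lerXn2r ?nnegrE ?sqrtr_ge0 //.
    by rewrite (le_trans _ (HM x)) // sqrtr_ge0.
  by rewrite /M -mulrA [sqnorm v * s]mulrC ler_wpM2l ?sqr_ge0.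
have := normc_l2dot (H x) q e0; rewrite sE normc_real ger0_norm // => hs.
have : l2norm (H x) ^+ 2 / e <= s.
  by rewrite ler_pdivrMr // (le_trans Hx) // mulrC ler_wpM2l // lerDl.
move: hs; lra.
Qed.

End Resolvent.

(** * Boundary values of a function and of its inverse *)

Section InversePair.
Context {R : realType} {p : nat}.
Local Notation C := R[i].
Local Notation mu := (@lebesgue_measure R).

Lemma cvg_mx_entry {T : Type} {m n : nat} {F : set_system T} {FF : Filter F}
  (Y : T -> 'M[C]_(m, n)) (L : 'M[C]_(m, n)) :
  (forall i j, Y x i j @[x --> F] --> L i j) -> Y @ F --> L.
Proof.
move=> YL A [P LP PA].
have : \forall x \near F, forall i j, P i j (Y x i j).
  apply: filter_forall => i; apply: filter_forall => j.
  exact: (YL i j _ (LP i j)).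
by apply: filterS => x Px; apply: PA => i j; exact: Px.
Qed.

Lemma radial_within t (alpha : R) : 1 < alpha ->
  (radii n)%:C%C * cis t @[n --> \oo] -->
    within (stolz_region alpha (cis t)) (nbhs (cis t)).
Proof.
move=> alpha1 A /(radii_cvg (t := t)) h.
have : \forall n \near \oo, stolz_region alpha (cis t) ((radii n)%:C%C * cis t) ->
  A ((radii n)%:C%C * cis t) by exact: h.
apply: filterS => n; apply.
exact: radial_stolz (radii_itv n).
Qed.

(** The second condition makes [invmx] the inverse matrix. *)
Definition hardy_invertible (Y : C -> 'M[C]_p) : Prop :=
  [/\ hardy_2_mx Y,
      (forall z : C, `|z| < 1 -> Y z \in unitmx),
      hardy_2_mx (fun z => invmx (Y z)) &
      {ae mu, forall t : R, t \in `[0, 2 * pi] ->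
         exists L : 'M[C]_p,
           nontangential_limit Y (circle_point 1 t) L /\ \det L != 0}].

(** By Fatou's theorem the entries of both functions have nontangential limits almost
   everywhere, and [Y z *m W z = 1] passes to the limit along the radius. *)
Lemma hardy_inverse_pair (Y W : C -> 'M[C]_p) (a b : 'I_p -> 'I_p -> C ^nat) :
  (forall i j, l2_coef (a i j)) -> (forall i j, l2_coef (b i j)) ->
  (forall i j z, normc z < 1 -> Y z i j = power_sum (a i j) z) ->
  (forall i j z, normc z < 1 -> W z i j = power_sum (b i j) z) ->
  (forall z, normc z < 1 -> Y z *m W z = 1%:M) ->
  hardy_invertible Y.
Proof.
move=> la lb Ya Wb YW.
have Yu z : normc z < 1 -> Y z \in unitmx by move=> /YW/mulmx1_unit[].
have YV z : normc z < 1 -> invmx (Y z) = W z.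
  by move=> z1; rewrite -[RHS](mulKmx (Yu z z1)) YW // mulmx1.
split.
- by move=> i j; apply: (power_sum_hardy_2 (la i j)) => z; exact: Ya.
- by move=> z; rewrite normc_lt1; exact: Yu.
- by move=> i j; apply: (power_sum_hardy_2 (lb i j)) => z z1; rewrite YV // Wb.
have aeY i j := l2_nontangential (la i j) (Ya i j).
have aeW i j := l2_nontangential (lb i j) (Wb i j).
have {}aeY := @filter_forall _ _ _ _ (ae_filter_ringOfSetsType mu)
  (fun i => @filter_forall _ _ _ _ (ae_filter_ringOfSetsType mu) (aeY i)).
have {}aeW := @filter_forall _ _ _ _ (ae_filter_ringOfSetsType mu)
  (fun i => @filter_forall _ _ _ _ (ae_filter_ringOfSetsType mu) (aeW i)).
apply: filterS2 aeY aeW => t Yt Wt tI.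
have sY i := choice (fun j => Yt i j tI).
have sW i := choice (fun j => Wt i j tI).
pose LY (i j : 'I_p) : C := projT1 (sY i) j.
pose LW (i j : 'I_p) : C := projT1 (sW i) j.
have LYP i j := projT2 (sY i) j; have LWP i j := projT2 (sW i) j.
pose L : 'M[C]_p := \matrix_(i, j) LY i j; pose L' : 'M[C]_p := \matrix_(i, j) LW i j.
exists L; split.
  by move=> alpha alpha1; apply: cvg_mx_entry => i j; rewrite mxE; exact: LYP.
have LL : L *m L' = 1%:M.
  apply/matrixP => i j.
  pose zn n : C := (radii n)%:C%C * cis t.
  have zn1 n : normc (zn n) < 1.
    have /andP[r0 r1] := radii_itv (R := R) n.
    by rewrite /zn normcM normc_cis mulr1 normc_real ger0_norm.
  have two1 : 1 < 2 :> R by rewrite ltr1n.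
  have cY k : Y (zn n) i k @[n --> \oo] --> L i k.
    rewrite mxE; apply: (@cvg_comp _ _ _ zn (fun z => Y z i k)); last exact: (LYP i k 2 two1).
    exact: radial_within.
  have cW k : W (zn n) k j @[n --> \oo] --> L' k j.
    rewrite mxE; apply: (@cvg_comp _ _ _ zn (fun z => W z k j)); last exact: (LWP k j 2 two1).
    exact: radial_within.
  have cS (s : seq 'I_p) : \sum_(k <- s) Y (zn n) i k * W (zn n) k j @[n --> \oo] -->
      \sum_(k <- s) L i k * L' k j.
    elim: s => [|k s IH].
      rewrite (_ : (fun n => _) = fun=> 0); last by apply/funext => n; rewrite big_nil.
      by rewrite big_nil; exact: cvg_cst.
    rewrite (_ : (fun n => _) = fun n => Y (zn n) i k * W (zn n) k j +
       \sum_(k <- s) Y (zn n) i k * W (zn n) k j); last first.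
      by apply/funext => n; rewrite big_cons.
    rewrite big_cons; apply: cvgD; last exact: IH.
    by apply: cvgM; [exact: cY|exact: cW].
  have := cS (index_enum 'I_p).
  rewrite (_ : (fun n => _) = fun=> (1%:M : 'M[C]_p) i j); last first.
    by apply/funext => n; rewrite -(YW _ (zn1 n)) mxE.
  move=> c; rewrite [LHS]mxE.
  have e : (fun _ : nat => (1%:M : 'M[C]_p) i j) @ \oo --> (1%:M : 'M[C]_p) i j.
    exact: cvg_cst.
  exact: (cvg_unique _ c e).
apply/eqP => L0; have := congr1 determinant LL.
by rewrite det_mulmx L0 mul0r det1 => /eqP; rewrite eq_sym oner_eq0.
Qed.

End InversePair.

(** * The function [Y] and its inverse *)

Section MatrixOf.
Context {R : realType} {n : nat}.
Local Notation C := R[i].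
Implicit Types f : 'cV[C]_n -> 'cV[C]_n.

Lemma matrix_of_delta f j : matrix_of f *m delta_mx j ord0 = f (delta_mx j ord0).
Proof. by rewrite -colE; apply/colP => i; rewrite !mxE. Qed.

Lemma matrix_of_mul f v : linear f -> matrix_of f *m v = f v.
Proof.
move=> lf; rewrite [in RHS](matrix_sum_delta v).
rewrite (big_morph f (linear_D lf) (linear_0 lf)); apply/colP => i.
rewrite mxE summxE; apply: eq_bigr => j _.
by rewrite big_ord1 (linear_Z lf) !mxE mulrC.
Qed.

Lemma mulmx_delta_eq1 (A : 'M[C]_n) :
  (forall j, A *m delta_mx j ord0 = delta_mx j ord0 :> 'cV_n) -> A = 1%:M.
Proof.
move=> h; apply/matrixP => i j; have := congr1 (fun v : 'cV_n => v i ord0) (h j).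
by rewrite -colE !mxE eqxx andbT.
Qed.

End MatrixOf.

Section OperatorIdentities.
Context {R : realType} {m p : nat}.
Local Notation C := R[i].
Variables (T : ell2 R p -> ell2 R m) (T' : ell2 R m -> ell2 R p).
Variables (Q : ell2 R m -> ell2 R m) (H : ell2 R p -> ell2 R m).
Variable A : nat -> 'M[C]_(m, p).
Hypothesis linT : linear T.
Hypothesis T_entry : forall i j (v : 'cV[C]_p),
  T (l2single j v) i = (if (j <= i)%N then A (i - j) else 0) *m v.
Hypothesis T_adj : forall u v, l2dot (T u) v = l2dot u (T' v).
Hypothesis gramK : cancel (T \o T') Q.
Hypothesis Kgram : cancel Q (T \o T').
Hypothesis H_bounded : bounded_operator H.
Hypothesis H_entry : forall i j (v : 'cV[C]_p), H (l2single j v) i = A (i + j + 1) *m v.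


Let K u := T' (Q u).
Let B v := bshift (T (l2embed v)).

Let T_adj' u v : l2dot (T' u) v = l2dot u (T v).
Proof. by rewrite l2dotC -T_adj -l2dotC. Qed.

Lemma adjoint_linear : linear T'.
Proof.
move=> c x y; apply: l2dot_injl => z.
by rewrite T_adj' !l2dotDl !l2dotZl !T_adj'.
Qed.

Let gram_linear : linear (T \o T').
Proof. by move=> c x y; rewrite /= adjoint_linear linT. Qed.

Let Q_linear : linear Q.
Proof. exact: (cancel_linear gramK Kgram gram_linear). Qed.

Let K_linear : linear K.
Proof. by move=> c x y; rewrite /K Q_linear adjoint_linear. Qed.

Let Q_selfadj u v : l2dot (Q u) v = l2dot u (Q v).
Proof.
by rewrite -{1}(Kgram v) -{2}(Kgram u) /= T_adj -T_adj'.
Qed.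

Let l2embed_linear n : linear (@l2embed R n).
Proof.
move=> c v w; apply: ell2_eq => -[|k]; rewrite ell2D ell2Z //=.
by rewrite scaler0 addr0.
Qed.

Let B_linear : linear B.
Proof. by move=> c v w; rewrite /B l2embed_linear linT bshift_linear. Qed.

(** The adjoint form of [T_shift], the commutation of an analytic Toeplitz operator with
   the shift.  It comes first because an adjoint is determined by the values of [T] on
   vectors with one nonzero coordinate, on which the commutation can be read off
   the block matrix. *)
Let adjoint_bshift y : T' (bshift y) = bshift (T' y).
Proof.
apply: ell2_eq => j; apply: cdot_inj => v.
rewrite -l2dot_single -T_adj -l2dot_shift.
have -> : Defs.shift (T (l2single j v)) = T (l2single j.+1 v).
  by apply: ell2_eq => -[|i]; rewrite /= !T_entry /= ?mul0mx // ltnS subSS.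
by rewrite T_adj l2dot_single.
Qed.

Let T_shift x : T (Defs.shift x) = Defs.shift (T x).
Proof.
apply: l2dot_injl => y.
by rewrite T_adj !l2dot_shift -adjoint_bshift -T_adj.
Qed.

Let bshift_T x : bshift (T x) = T (bshift x) + B (x 0%N).
Proof.
rewrite -{1}(embed_shift x) (linear_D linT) T_shift.
by rewrite -{1}(scale1r (T _)) bshift_linear scale1r shiftK addrC.
Qed.

Let TK u : T (K u) = u. Proof. exact: Kgram. Qed.

(** The right inverse [K] of [T] commutes with the backward shift up to the operator
   [K \o B] applied to the first coordinate.  Indeed [T] has this property by [bshift_T],
   and applying [K] to [T (bshift (K u))] restores [bshift (K u)], which lies in the range
   of [T'], where [K \o T] is the identity. *)
Lemma right_inverse_bshift u : K (bshift u) = bshift (K u) + K (B (K u 0%N)).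
Proof.
have /esym e : K (T (bshift (K u))) = bshift (K u).
  by rewrite /K -adjoint_bshift gramK.
have bK : T (bshift (K u)) = bshift u - B (K u 0%N).
  by rewrite -[in RHS](TK u) bshift_T TK addrK.
by rewrite e -(linear_D K_linear) bK subrK.
Qed.

Section Point.
Variable z : C.
Hypothesis z1 : normc z < 1.

Let Rm := inverse (fun x : ell2 R m => x - z *: bshift x).
Let Rp := inverse (fun x : ell2 R p => x - z *: bshift x).

Let Rp_linear : linear Rp.
Proof.
have [h1 h2] := inverse_resolvent (n := p) z1.
apply: (cancel_linear h1 h2) => c x y.
by rewrite bshift_linear scalerDr opprD scalerA mulrC -scalerA addrACA -scalerBr.
Qed.

(** The state space computation behind [Y_mulmx_W]: by [right_inverse_bshift], the vector
   [K (B (v + z *: w))] is the image of [K (Rm (B v))] under [x |-> x - z *: bshift x]. *)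
Lemma resolvent_solution (v : 'cV[C]_p) :
  let w := K (Rm (B v)) 0%N in Rp (K (B (v + z *: w))) 0%N = w.
Proof.
move=> w; set u := Rm (B v).
have [h1 h2] := inverse_resolvent (n := p) z1.
have [_ h3] := inverse_resolvent (n := m) z1.
have ub : u - z *: bshift u = B v by exact: h3.
suff -> : K (B (v + z *: w)) = K u - z *: bshift (K u) by rewrite /Rp h1.
rewrite (linear_D B_linear) (linear_Z B_linear) (linear_D K_linear) (linear_Z K_linear).
rewrite -ub (linear_D K_linear) -scaleNr (linear_Z K_linear).
by rewrite right_inverse_bshift scalerDr -/w !scaleNr addrA subrK.
Qed.

Let Y := 1%:M - z *: matrix_of (fun v => Rp (K (H (l2embed v))) 0%N).
Let W := 1%:M + z *: matrix_of (fun v => K (Rm (B v)) 0%N).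

Let H_embed v : H (l2embed v) = B v.
Proof.
apply: ell2_eq => i; rewrite H_entry /= T_entry leq0n subn0.
by rewrite addn0 addn1.
Qed.

Lemma Y_mulmx_W : Y *m W = 1%:M.
Proof.
have Yv v : Y *m v = v - z *: Rp (K (B v)) 0%N.
  rewrite /Y mulmxBl mul1mx -scalemxAl; congr (_ - _ *: _).
  rewrite matrix_of_mul ?H_embed // => c x y.
  by rewrite !H_embed B_linear K_linear Rp_linear ell2D.
apply: mulmx_delta_eq1 => j; rewrite -mulmxA.
rewrite [W *m _]mulmxDl mul1mx -scalemxAl matrix_of_delta Yv.
by rewrite resolvent_solution addrK.
Qed.

Lemma Y_entry i j :
  Y i j = power_sum (pcons (1%:M i j)
    (fun k => -1 * K (H (l2embed (delta_mx j ord0))) k i ord0)) z.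
Proof.
have [_ h2] := inverse_resolvent (n := p) z1.
set x := K (H (l2embed (delta_mx j ord0))).
have lx : disc_summable (fun k => x k i ord0) by apply: l2_coef_summable; exact: l2_coef_entry.
have lx' := l2_coef_summable (l2_coefZ (-1) (l2_coef_entry x i)).
rewrite (power_sum_pcons _ lx' z1) (power_sumZ _ lx z1) /Y !mxE -/x.
congr (_ + _); rewrite mulN1r mulrN; congr (- (_ * _)).
have lE := resolvent_dot (l2embed (delta_mx i ord0)) z1 (h2 x).
rewrite l2dotC l2dot_single -cdotC cdot_delta -/Rp in lE.
rewrite lE; congr power_sum; apply/funext => k.
by rewrite l2dotC l2dot_single -cdotC cdot_delta iter_bshiftE.
Qed.

(** The [k]-th iterate of the backward shift on the first block column of a Hankel
   matrix is its [k]-th block column.  Hence the coefficients of [W] are values of one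
   functional on the vectors of the [k]-th coordinate, as in [l2_coef_functional]. *)
Lemma W_entry i j :
  W i j = power_sum (pcons (1%:M i j) (fun k => l2dot (H (l2single k (delta_mx j ord0)))
    (Q (T (l2embed (delta_mx i ord0)))))) z.
Proof.
have [_ h2] := inverse_resolvent (n := m) z1.
rewrite power_sum_pcons //; last first.
  by apply: l2_coef_summable; exact: l2_coef_functional.
rewrite /W !mxE; congr (_ + _ * _).
rewrite -[LHS]cdot_delta cdotC -l2dot_single -l2dotC /K T_adj' Q_selfadj.
have -> := resolvent_dot (Q (T (l2embed (delta_mx i ord0)))) z1 (h2 (B (delta_mx j ord0))).
apply: (congr1 (fun a => power_sum a z)); apply/funext => k.
congr l2dot; apply: ell2_eq => l.
rewrite iter_bshiftE H_entry /= T_entry leq0n subn0.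
by rewrite addn1.
Qed.

End Point.

(** The coefficients of [Y] are entries of vectors of [ell^2], those of its inverse are
   values of a bounded functional: both are square summable. *)
Lemma hardy_invertible_state_space (Y : C -> 'M[C]_p) :
  (forall z, Y z = 1%:M - z *: matrix_of (fun v =>
     inverse (fun x : ell2 R p => x - z *: bshift x) (T' (Q (H (l2embed v)))) 0%N)) ->
  hardy_invertible Y.
Proof.
move=> YE.
apply: (hardy_inverse_pair (W := fun z => 1%:M + z *: matrix_of (fun v =>
   K (inverse (fun x : ell2 R m => x - z *: bshift x) (B v)) 0%N))
  (a := fun i j => pcons (1%:M i j)
     (fun k => -1 * K (H (l2embed (delta_mx j ord0))) k i ord0))
  (b := fun i j => pcons (1%:M i j)
     (fun k => l2dot (H (l2single k (delta_mx j ord0)))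
        (Q (T (l2embed (delta_mx i ord0))))))).
- by move=> i j; apply: l2_coef_pcons; apply: l2_coefZ; exact: l2_coef_entry.
- by move=> i j; apply: l2_coef_pcons; exact: l2_coef_functional.
- by move=> i j z z1; rewrite YE; exact: Y_entry.
- by move=> i j z z1; exact: W_entry.
- by move=> z z1; rewrite YE; exact: Y_mulmx_W.
Qed.

End OperatorIdentities.

Section Degenerate.
Context {R : realType} {m p : nat}.
Local Notation C := R[i].

Lemma Y_funE (G : C -> 'M[C]_(m, p)) z :
  Y_fun G z = 1%:M - z *: matrix_of (fun v =>
    inverse (fun x : ell2 R p => x - z *: bshift x)
      (adjoint (@l2dot R p) (@l2dot R m) (Toeplitz G)
        (inverse (Toeplitz_gram G) (Hankel G (l2embed v)))) 0%N).
Proof. by rewrite /Y_fun adjoint_shift adjoint_embed. Qed.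

Lemma hardy_invertible_identity (Y : C -> 'M[C]_p) : (forall z, normc z < 1 -> Y z = 1%:M) ->
  hardy_invertible Y.
Proof.
move=> Y1.
have l0 : l2_coef (fun=> 0 : C).
  by exists 0 => n; rewrite big1 // => k _; rewrite normc0 expr0n.
have d0 := l2_coef_summable l0.
have c0 (c z : C) : normc z < 1 -> c = power_sum (pcons c (fun=> 0)) z.
  move=> z1; rewrite (power_sum_pcons _ d0 z1) (_ : (fun=> 0) = fun=> 0 * (0 : C)).
    by rewrite (power_sumZ 0 d0 z1) mul0r mulr0 addr0.
  by apply/funext => k; rewrite mul0r.
have lp c := l2_coef_pcons c l0.
apply: (hardy_inverse_pair (W := fun=> 1%:M)
  (a := fun i j => pcons (1%:M i j) (fun=> 0))
  (b := fun i j => pcons (1%:M i j) (fun=> 0))) => [i j|i j|i j z z1|i j z z1|z z1].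
- exact: lp.
- exact: lp.
- by rewrite Y1 //; exact: c0.
- exact: c0.
- by rewrite Y1 // mulmx1.
Qed.

Lemma block_operatorP (A : nat -> nat -> 'M[C]_(m, p)) :
  block_operator A = (fun=> 0) \/
  bounded_operator (block_operator A) /\
  forall i j (v : 'cV[C]_p), block_operator A (l2single j v) i = A i j *m v.
Proof. by rewrite /block_operator; case: xgetP => [T _|_]; [right|left]. Qed.

End Degenerate.

Theorem proposition4p2 (R : realType) (m p : nat) (G : R[i] -> 'M[R[i]]_(m, p))
    (G_Hinf : hardy_inf_mx G)
    (TGTG_pos : strictly_positive (Toeplitz_gram G)) :
  [/\ hardy_2_mx (Y_fun G),
      (forall z : R[i], `|z| < 1 -> Y_fun G z \in unitmx),
      hardy_2_mx (fun z => invmx (Y_fun G z)) &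
      {ae (@lebesgue_measure R), forall t : R, t \in `[0, 2 * pi] ->
         exists L : 'M[R[i]]_p,
           nontangential_limit (Y_fun G) (circle_point 1 t) L /\ \det L != 0}].
Proof.
(* Each of the four operators is either the genuine one or the zero map; in the
   latter case the state [T' (Q (H (l2embed v)))] vanishes and [Y] is the identity. *)
pose T := Toeplitz G; pose T' := adjoint (@l2dot R p) (@l2dot R m) T.
pose Q := inverse (Toeplitz_gram G); pose H := Hankel G.
have trivial : (forall v, T' (Q (H (l2embed v))) = 0) ->
    forall z, normc z < 1 -> Y_fun G z = 1%:M.
  move=> K0 z z1; rewrite Y_funE.
  have [h1 _] := inverse_resolvent (n := p) z1.
  have R0 : inverse (fun x : ell2 R p => x - z *: bshift x) 0 = 0.
    rewrite -[RHS]h1; congr (inverse _ _).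
    by apply: ell2_eq => k; rewrite ell2B ell2Z /= scaler0 subr0.
  have -> : matrix_of (fun v => inverse (fun x : ell2 R p => x - z *: bshift x)
      (T' (Q (H (l2embed v)))) 0%N) = 0.
    by apply/matrixP => i j; rewrite !mxE K0 R0 [LHS]mxE.
  by rewrite scaler0 subr0.
have T'D : (forall u v, l2dot (T u) v = l2dot u (T' v)) \/ T' = fun=> 0.
  by rewrite /T' /adjoint; case: xgetP => [S _ /= Sadj|_]; [left|right].
have QD : (cancel (T \o T') Q /\ cancel Q (T \o T')) \/ Q = fun=> 0.
  by rewrite /Q /inverse; case: xgetP => [S _ /= SK|_]; [left|right].
case: T'D => [T_adj|T'0]; last by apply/hardy_invertible_identity/trivial => v; rewrite T'0.
have T'_linear := adjoint_linear T_adj.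
case: QD => [[gramK Kgram]|Q0]; last first.
  by apply/hardy_invertible_identity/trivial => v; rewrite Q0 (linear_0 T'_linear).
have [T0|[[T_linear _] T_entry]] :=
    block_operatorP (fun i j => if (j <= i)%N then taylor_mx G (i - j) else 0).
  apply/hardy_invertible_identity/trivial => v; apply: l2dot_inj => u.
  by rewrite -T_adj /T /Toeplitz T0 l2dot0l l2dotC l2dot0l conjC0.
have [H0|[H_bounded H_entry]] := block_operatorP (fun i j => taylor_mx G (i + j + 1)).
  apply/hardy_invertible_identity/trivial => v; rewrite /H /Hankel H0 -(linear_0 T'_linear).
  congr (T' _); rewrite -[RHS](gramK 0); congr Q.
  by rewrite /= (linear_0 T'_linear) (linear_0 (T_linear : linear T)).
apply: (hardy_invertible_state_space T_linear T_entry T_adj gramK Kgram H_bounded H_entry) => z.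
exact: Y_funE.
Qed.
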